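(* Let $M=(a,b)\times N$ carry the metrics $g=dr^2+G(r)$ and $g_0=dr^2+\mathring{h}^2(r)\hat G$ described in the context, and let $\mathcal M(r)$ be the relative radial mass of $g$ with respect to $g_0$. Suppose that the limits $\mathcal M(a):=\lim_{r\to a}\mathcal M(r)$ and $\mathcal M(b):=\lim_{r\to b}\mathcal M(r)$ exist (as real numbers), that $\mathring{h}^{2}(R_{rr}-\mathring{R}_{rr})\in L^1(M,dr\,d\mu_{\hat G})$, and that $\mathcal M(b)\leq\mathcal M(a)$. Then $$\int_M\mathring{h}^{2}(R_{rr}-\mathring{R}_{rr})\,dr\,d\mu_{\hat{G}}\leq 0,$$ with equality if and only if $G(r)=\mathring{h}^2(r)\widetilde{G}$ for all $r\in(a,b)$, for some fixed (independent of $r$) Riemannian metric $\widetilde{G}$ on $N$. If furthermore $g$ is asymptotic to $g_0$ at some $r_0\in[a,b]$, then equality holds if and only if $g=g_0$.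
   Context: Let $n\geq 2$, let $N$ be a compact $(n-1)$-dimensional smooth manifold (with or without boundary), let $(a,b)$ be an open interval of $\mathbb R$ (possibly unbounded), and $M=(a,b)\times N$, with $r$ the coordinate on $(a,b)$. All objects are assumed $C^\infty$. Let $g=dr^2+G(r)$ be a Riemannian metric on $M$, where $G(r)$ is a family of Riemannian metrics on $N$. Let $g_0=dr^2+\mathring{G}(r)$ with $\mathring{G}(r)=\mathring{h}^2(r)\hat{G}$, where $\mathring{h}$ is a positive function on $(a,b)$ and $\hat{G}$ is a fixed Riemannian metric on $N$, with Riemannian measure $\mu_{\hat G}$. Let $N(r)=\{r\}\times N$, and let $H$ and $\mathring H$ be the mean curvatures (traces of the Weingarten maps with respect to $\partial_r$) of $N(r)$ relative to $g$ and $g_0$: $H=\frac12\operatorname{Tr}(G^{-1}\partial_rG)$ and $\mathring H=(n-1)\mathring h'/\mathring h$. The radial mass at $(r,x)\in M$ is $m(r,x)=\mathring{h}^{2}(\mathring{H}-H)$, and the relative radial mass on $N(r)$ is $\mathcal M(r)=\int_N m(r,x)\,d\mu_{\hat G}(x)$. $R_{rr}$ and $\mathring R_{rr}=-(n-1)\mathring h''/\mathring h$ denote the Ricci curvatures in the $(\partial_r,\partial_r)$ direction of $g$ and $g_0$ respectively. $g$ is said to be asymptotic to $g_0$ at $r_0\in[a,b]$ if $\|G-\mathring G\|_{\mathring G}=o(1)$ as $r\to r_0$, uniformly on $N$ (pointwise norm of tensors on $N$ with respect to $\mathring G(r)$); for $r_0\in(a,b)$ this means that the two metrics coincide on $N(r_0)$.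 *)

(* Defs.v *)
From HB Require Import structures.
From mathcomp Require Import all_boot all_order all_algebra.
From mathcomp Require Import all_classical all_reals all_analysis.

Set Implicit Arguments.
Unset Strict Implicit.
Unset Printing Implicit Defensive.

Import Order.TTheory GRing.Theory Num.Theory.
Import numFieldNormedType.Exports.

Local Open Scope classical_set_scope.
Local Open Scope ring_scope.

Section Calculus.
Variables (R : realType) (d : nat).
Implicit Types (D U : set 'rV[R]_d) (f F : 'rV[R]_d -> R).

Definition basis_vec (i : 'I_d) : 'rV[R]_d := delta_mx 0 i.

(* For open U: all iterated partial derivatives up to order k exist and are
   continuous on U. *)
Fixpoint Ck (k : nat) U F : Prop :=
  (forall x, U x -> {for x, continuous F}) /\
  (if k is k'.+1 then
     forall i, (forall x, U x -> derivable F x (basis_vec i)) /\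
               Ck k' U (fun x => 'D_(basis_vec i) F x)
   else True).

(* Smoothness on a possibly non-open set (charts at the boundary are modelled
   on a half-space): local extendability to a C^infinity function. *)
Definition smooth_on D f : Prop :=
  forall x, D x -> exists U F,
    [/\ open U, U x, forall k, Ck k U F & forall y, U y -> D y -> f y = F y].

(* Partial derivative computed within D, hence one-sided in the normal
   direction at a boundary point of a half-space. *)
Definition partial D f (x : 'rV[R]_d) (i : 'I_d) : R :=
  lim ((f (x + t *: basis_vec i) - f x) / t
       @[t --> within [set t : R | D (x + t *: basis_vec i)] (0 : R)^']).

Definition half_space : set 'rV[R]_d :=
  [set x | forall i : 'I_d, (i : nat) = 0%N -> 0 <= x ord0 i].

Section Curvature.
Variables (D : set 'rV[R]_d) (g : 'rV[R]_d -> 'M[R]_d).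

(* christoffel x l i j is Gamma^l_{ij} at x *)
Definition christoffel (x : 'rV[R]_d) (l i j : 'I_d) : R :=
  2^-1 * \sum_p invmx (g x) l p *
    (partial D (fun y => g y p j) x i + partial D (fun y => g y p i) x j
     - partial D (fun y => g y i j) x p).

(* Ric_ij = the contraction of the curvature tensor with the sign making round spheres positive *)
Definition ricci (x : 'rV[R]_d) (i j : 'I_d) : R :=
  \sum_l (partial D (fun y => christoffel y l i j) x l
          - partial D (fun y => christoffel y l i l) x j)
  + \sum_l \sum_p (christoffel x l l p * christoffel x p i j
                   - christoffel x l j p * christoffel x p i l).

End Curvature.
End Calculus.

(* Integral over R^d with respect to Lebesgue measure, as an iterated integral
   (only used for nonnegative Borel functions, where Tonelli applies). *)
Fixpoint lebesgue_integral_rV (R : realType) (d : nat) :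
    ('rV[R]_d -> \bar R) -> \bar R :=
  if d is d'.+1 then fun f =>
    (\int[@lebesgue_measure R]_t
       lebesgue_integral_rV (fun y : 'rV[R]_d' =>
         f (row_mx (const_mx t : 'rV[R]_1) y)))%E
  else fun f => f 0.

Record chart (R : realType) (m : nat) (T : topologicalType) := Chart {
  cdom : set T;
  cmap : T -> 'rV[R]_m;
  cinv : 'rV[R]_m -> T;
}.

Definition cimage (R : realType) (m : nat) (T : topologicalType)
  (c : chart R m T) : set 'rV[R]_m := cmap c @` cdom c.

Definition is_chart (R : realType) (m : nat) (T : topologicalType)
    (c : chart R m T) : Prop :=
  [/\ open (cdom c),
      exists2 V : set 'rV[R]_m, open V & cimage c = V `&` @half_space R m,
      forall x, cdom c x -> cinv c (cmap c x) = x,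
      {within cdom c, continuous (cmap c)} &
      {within cimage c, continuous (cinv c)}].

Definition overlap (R : realType) (m : nat) (T : topologicalType)
  (c c' : chart R m T) : set 'rV[R]_m := cmap c @` (cdom c `&` cdom c').

Definition transition (R : realType) (m : nat) (T : topologicalType)
  (c c' : chart R m T) (i : 'I_m) (y : 'rV[R]_m) : R :=
  cmap c' (cinv c y) ord0 i.

(* Smooth manifold of dimension m, with or without boundary. The carrier is
   pointed (hence nonempty) because the measure theory library requires it. *)
Record manifold (R : realType) (m : nat) := Manifold {
  carrier :> ptopologicalType;
  atlas : set (chart R m carrier);
  chart_at : carrier -> chart R m carrier;
  manifold_hausdorff : hausdorff_space carrier;
  manifold_second_countable : @second_countable carrier;
  atlas_chart : forall c, atlas c -> is_chart c;
  atlas_transition : forall c c', atlas c -> atlas c' ->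
    forall i, smooth_on (overlap c c') (transition c c' i);
  chart_at_atlas : forall x, atlas (chart_at x);
  mem_chart_at : forall x, cdom (chart_at x) x;
}.

Section Tensors.
Variables (R : realType) (m : nat) (N : manifold R m).

(* A (0,2)-tensor field is given by its component matrices in all charts;
   T c x is relevant only for c in the atlas and x in the domain of c. *)
Definition tensor2 := chart R m N -> N -> 'M[R]_m.

(* Entry (j, i) is the j-th partial derivative of the i-th new coordinate, as
   vectors are rows. *)
Definition jacobian (c c' : chart R m N) (x : N) : 'M[R]_m :=
  \matrix_(j, i) partial (overlap c c') (transition c c' i) (cmap c x) j.

Definition riemannian (T : tensor2) : Prop :=
  [/\ forall c x, atlas c -> cdom c x ->
        (T c x)^T = T c x /\
        forall v : 'rV[R]_m, v != 0 -> 0 < (v *m T c x *m v^T) ord0 ord0,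
      forall c i j, atlas c ->
        smooth_on (cimage c) (fun y => T c (cinv c y) i j) &
      forall c c' x, atlas c -> atlas c' -> cdom c x -> cdom c' x ->
        T c x = jacobian c c' x *m T c' x *m (jacobian c c' x)^T].

Definition borel := g_sigma_algebraType (@open N).

(* On Borel subsets of a chart domain the measure has density (det T)^{1/2};
   this determines mu, as countably many chart domains cover N. *)
Definition riemannian_measure (T : tensor2)
    (mu : set borel -> \bar R) : Prop :=
  forall c (A : set borel), atlas c -> measurable A -> A `<=` cdom c ->
    mu A = lebesgue_integral_rV (fun y =>
      (\1_(cmap c @` A) y * Num.sqrt (\det (T c (cinv c y))))%:E).

(* |T|_g = (g^{ik} g^{jl} T_ij T_kl)^{1/2} at x *)
Definition tensor_norm (g T : tensor2) (x : N) : R :=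
  let gi := invmx (g (chart_at x) x) in
  let S := T (chart_at x) x in
  Num.sqrt (\tr (gi *m S *m gi *m S^T)).

End Tensors.

Section Cylinder.
Variables (R : realType) (m : nat) (N : manifold R m) (a b : \bar R).

Definition ioo : set R := [set r | (a < r%:E < b)%E].

(* The filter of r -> r0 with r in (a, b), where r0 may be infinite. *)
Definition to_within (r0 : \bar R) : set_system R :=
  filter_from (nbhs r0) (fun U => [set r | ioo r /\ U r%:E]).

Definition cyl_point (r : R) (y : 'rV[R]_m) : 'rV[R]_(1 + m) :=
  row_mx (const_mx r) y.

Definition cyl_domain (c : chart R m N) : set 'rV[R]_(1 + m) :=
  [set z | ioo (lsubmx z ord0 ord0) /\ cimage c (rsubmx z)].

(* dr^2 + G(r) in the product chart (r, c) *)
Definition cyl_metric (G : R -> tensor2 N) (c : chart R m N)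
    (z : 'rV[R]_(1 + m)) : 'M[R]_(1 + m) :=
  block_mx 1%:M 0 0 (G (lsubmx z ord0 ord0) c (cinv c (rsubmx z))).

Definition metric_family (G : R -> tensor2 N) : Prop :=
  (forall r, ioo r -> riemannian (G r)) /\
  (forall c i j, atlas c ->
     smooth_on (cyl_domain c) (fun z => cyl_metric G c z i j)).

Definition smooth_fun (h : R -> R) : Prop :=
  forall k r, ioo r -> derivable (derive1n k h) r 1.

Definition warped (h : R -> R) (T : tensor2 N) : R -> tensor2 N :=
  fun r c x => h r ^+ 2 *: T c x.

(* Independent of the chart, hence computed in the preferred chart at x; the
   same holds for ricci_rr and tensor_norm. *)
Definition mean_curvature (G : R -> tensor2 N) (r : R) (x : N) : R :=
  let c := chart_at x in
  2^-1 * \tr (invmx (G r c x) *m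
              \matrix_(i, j) derive1 (fun s => G s c x i j) r).

Definition ricci_rr (G : R -> tensor2 N) (r : R) (x : N) : R :=
  let c := chart_at x in
  ricci (cyl_domain c) (cyl_metric G c) (cyl_point r (cmap c x))
    (lshift m ord0) (lshift m ord0).

Definition radial_mass (h : R -> R) (Ghat : tensor2 N) (G : R -> tensor2 N)
    (r : R) (x : N) : R :=
  h r ^+ 2 * (mean_curvature (warped h Ghat) r x - mean_curvature G r x).

Definition relative_radial_mass (mu : {measure set (borel N) -> \bar R})
    (h : R -> R) (Ghat : tensor2 N) (G : R -> tensor2 N) (r : R) : R :=
  (\int[mu]_x radial_mass h Ghat G r x)%R.

Definition ricci_excess (h : R -> R) (Ghat : tensor2 N) (G : R -> tensor2 N)
    (p : R * N) : R :=
  h p.1 ^+ 2 * (ricci_rr G p.1 p.2 - ricci_rr (warped h Ghat) p.1 p.2).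

Definition asymptotic (G G0 : R -> tensor2 N) (r0 : \bar R) : Prop :=
  forall e : R, 0 < e -> \forall r \near to_within r0,
    forall x : N, tensor_norm (G0 r) (fun c y => G r c y - G0 r c y) x < e.

Definition same_metric (G G0 : R -> tensor2 N) : Prop :=
  forall c z, atlas c -> cyl_domain c z -> cyl_metric G c z = cyl_metric G0 c z.

End Cylinder.

(* Main.v *)
Require Import Defs.
From HB Require Import structures.
From mathcomp Require Import all_boot all_order all_algebra perm.
From mathcomp Require Import ring lra.
From mathcomp Require Import all_classical all_reals all_analysis measurable_realfun.

Set Implicit Arguments.
Unset Strict Implicit.
Unset Printing Implicit Defensive.

Import Order.TTheory GRing.Theory Num.Theory.
Import numFieldNormedType.Exports.

Local Open Scope classical_set_scope.
Local Open Scope ring_scope.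

(** Let W = G^-1 G' / 2 be the shape operator of the level sets of r in the
    metric g, so that H = tr W, and let k = h'/h, so that k times the identity
    is the shape operator in the model. Writing out the Christoffel symbols of
    a metric dr^2 + G(r) gives the traced Riccati equation
    R_rr = - (tr W)' - tr (W^2) ([ricci_radial]). Subtracting the two equations
    and completing the square with the weight h^2 yields the pointwise identity
    [ricci_excessE]:
      h^2 (R_rr - R0_rr) = m' - q,   q = h^2 tr (A^2),   A = W - k,
    with m the radial mass. Since A = G^-1 S with S symmetric, q is h^2 times
    the squared G-norm of S ([trace_normE]): it is nonnegative, and it vanishes
    only if G' = 2 k G.

    Integrating over [u, v] x N, by the fundamental theorem of calculus in r
    and Fubini ([integral_radial_derivative]), the left-hand side gives the
    increment of the relative radial mass between u and v minus the integral of
    q. When u and v tend to the ends, dominated convergence gives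
      integral of h^2 (R_rr - R0_rr) <= M(b) - M(a) - integral of q over K
    for every compact strip K ([integral_excess_le]), hence the inequality. In
    case of equality q has integral zero on all strips; being continuous and
    nonnegative it vanishes, as the measure charges every nonempty open set
    ([defect_eq0]). Then G' = 2 k G says that G / h^2 is constant in r
    ([defect_eq0_warped]). Conversely, a warped metric has the same shape
    operator as the model, hence the same radial Ricci curvature
    ([warped_excess0]). Finally the distance between two metrics with the same
    warping factor does not depend on r, so that being asymptotic anywhere
    forces them to agree ([asymptotic_warped]).

    The curvature quantities are computed in a preferred chart at each point,
    so that their continuity in the point rests on their invariance under
    changes of charts; this holds because the Jacobians of the transition maps
    do not depend on r ([weingarten_conj]). *)

(** * Positive definite matrices *)

Definition posdef (R : realType) (m : nat) (G : 'M[R]_m) : Prop :=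
  G^T = G /\ forall v : 'rV[R]_m, v != 0 -> 0 < (v *m G *m v^T) ord0 ord0.

(** Gaussian elimination on the first row and column: the Schur complement is
    again positive definite, so that a positive definite form has an
    orthonormal basis, given by the rows of [P]. *)
Lemma posdef_orthonormalize (R : realType) (m : nat) (G : 'M[R]_m) :
  posdef G -> exists2 P : 'M[R]_m, P \in unitmx & P *m G *m P^T = 1%:M.
Proof.
elim: m G => [|m IH] G pG.
  by exists 1%:M; [rewrite unitmx1 | apply/matrixP => -[]].
have [symG posG] : @posdef R (1 + m) G := pG.
pose g := (ulsubmx (G : 'M[R]_(1 + m))) ord0 ord0.
pose v : 'rV[R]_m := ursubmx (G : 'M[R]_(1 + m)).
pose G1 : 'M[R]_m := drsubmx (G : 'M[R]_(1 + m)).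
have GE : G = block_mx g%:M v v^T G1 :> 'M[R]_(1 + m).
  rewrite -[LHS](@submxK R 1 m 1 m) -mx11_scalar; congr block_mx.
  by rewrite /v trmx_ursub symG.
have symG1 : G1^T = G1 by rewrite /G1 trmx_drsub symG.
have g0 : 0 < g.
  have := posG (row_mx 1%:M 0 : 'rV[R]_(1 + m)).
  rewrite GE mul_row_block tr_row_mx mul_row_col trmx1 trmx0 !mulmx0 !mul0mx.
  rewrite mul1mx mulmx1 !addr0 !mxE eqxx mulr1n; apply.
  apply/eqP => /(congr1 (fun A : 'rV[R]_(1 + m) => A ord0 (lshift m ord0))).
  by rewrite row_mxEl !mxE eqxx => /eqP; rewrite oner_eq0.
pose L : 'M[R]_(1 + m) := block_mx 1%:M 0 (- (g^-1 *: v^T)) 1%:M.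
(* the Schur complement *)
pose C : 'M[R]_m := G1 - g^-1 *: (v^T *m v).
have LGL : L *m (G : 'M[R]_(1 + m)) *m L^T = block_mx g%:M 0 0 C.
  rewrite GE /L tr_block_mx mulmx_block mulmx_block !trmx1 trmx0.
  rewrite !(mul0mx, mulmx0, mul1mx, mulmx1, addr0, add0r).
  rewrite linearN linearZ /= trmxK !(mulNmx, mulmxN, mul_scalar_mx, mul_mx_scalar).
  rewrite !scalerA mulfV ?gt_eqF // !scale1r !addNr mul0mx oppr0 add0r.
  by rewrite -scalemxAl addrC.
have unitL : L \in unitmx.
  by rewrite unitmxE /L det_lblock !det1 mulr1 unitr1.
have posC : posdef C.
  split; first by rewrite /C linearB linearZ /= trmx_mul trmxK symG1.
  move=> w w0.
  have := posG ((row_mx 0 w : 'rV[R]_(1 + m)) *m L).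
  rewrite trmx_mul !mulmxA -(mulmxA _ L) -(mulmxA _ (L *m _)) LGL.
  rewrite mul_row_block tr_row_mx mul_row_col !(mul0mx, mulmx0, add0r) trmx0.
  rewrite mul_mx_row mul_row_col !mulmx0 add0r; apply.
  apply: contra w0 => /eqP /(congr1 (@rsubmx _ _ 1 _)).
  by rewrite row_mxKr linear0 mulmx1 => ->.
have [P1 uP1 P1C] := IH _ posC.
pose D : 'M[R]_(1 + m) := block_mx (Num.sqrt g)^-1%:M 0 0 P1.
have sg0 : Num.sqrt g != 0 by rewrite gt_eqF // sqrtr_gt0.
have gE : (Num.sqrt g)^-1 * g * (Num.sqrt g)^-1 = 1.
  by rewrite -[X in _ * X * _](sqr_sqrtr (ltW g0)) expr2 mulKf // divff.
have unitD : D \in unitmx.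
  rewrite unitmxE /D det_ublock det_scalar1 unitrM -unitmxE uP1 andbT.
  by rewrite unitfE invr_eq0.
exists (D *m L); first by rewrite unitmx_mul unitL andbT.
suff : D *m (L *m (G : 'M[R]_(1 + m)) *m L^T) *m D^T = 1%:M.
  by rewrite trmx_mul !mulmxA.
rewrite LGL /D tr_block_mx.
rewrite !mulmx_block !(mul0mx, mulmx0, add0r, addr0, trmx0) P1C.
by rewrite tr_scalar_mx -!scalar_mxM gE -scalar_mx_block.
Qed.

Lemma posdef_unit (R : realType) (m : nat) (G : 'M[R]_m) :
  posdef G -> G \in unitmx.
Proof.
move=> /posdef_orthonormalize[P uP e].
have := unitmx1 R m; rewrite -e unitmx_mul => /andP[].
by rewrite unitmx_mul => /andP[].
Qed.

(** In a basis orthonormal for [G] this trace is the sum of the squares of the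
    entries. *)
Lemma trace_normE (R : realType) (m : nat) (G S : 'M[R]_m) : posdef G ->
  exists2 P : 'M[R]_m, P \in unitmx &
    \tr (invmx G *m S *m invmx G *m S^T)
      = \sum_i \sum_j (P *m S *m P^T) i j ^+ 2.
Proof.
move=> pG; have uG := posdef_unit pG; have [P uP PG] := posdef_orthonormalize pG.
exists P => //.
have -> : invmx G = P^T *m P.
  apply: (can_inj (mulmxK uG)); rewrite mulVmx //; apply: (can_inj (mulKmx uP)).
  have uPT : P^T \in unitmx by rewrite unitmx_tr.
  apply: (can_inj (mulmxK uPT)).
  rewrite mulmx1 !mulmxA -[in RHS](mulmxA _ P) -[in RHS](mulmxA _ (P *m G)).
  by rewrite PG mulmx1.
rewrite -!mulmxA mxtrace_mulC -!mulmxA.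
transitivity (\tr ((P *m S *m P^T) *m (P *m S *m P^T)^T)).
  by rewrite !trmx_mul trmxK !mulmxA.
rewrite /mxtrace; apply: eq_bigr => i _; rewrite [LHS]mxE.
by apply: eq_bigr => j _; rewrite [(_^T) j i]mxE expr2 !mulmxA.
Qed.

Lemma trace_norm_ge0 (R : realType) (m : nat) (G S : 'M[R]_m) : posdef G ->
  0 <= \tr (invmx G *m S *m invmx G *m S^T).
Proof.
move=> /trace_normE -/(_ S)[P _ ->].
by apply: sumr_ge0 => i _; apply: sumr_ge0 => j _; exact: sqr_ge0.
Qed.

Lemma trace_norm_eq0 (R : realType) (m : nat) (G S : 'M[R]_m) : posdef G ->
  \tr (invmx G *m S *m invmx G *m S^T) = 0 -> S = 0.
Proof.
move=> /trace_normE -/(_ S)[P uP ->] /eqP.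
rewrite psumr_eq0 => [/allP s0|i _]; last by apply: sumr_ge0 => j _; exact: sqr_ge0.
have PSP : P *m S *m P^T = 0.
  apply/matrixP => i j; rewrite [RHS]mxE.
  have := s0 i (mem_index_enum _).
  rewrite psumr_eq0 => [/allP /(_ j (mem_index_enum _))|k _]; last exact: sqr_ge0.
  by rewrite sqrf_eq0 => /eqP.
apply: (can_inj (mulKmx uP)).
have uPT : P^T \in unitmx by rewrite unitmx_tr.
apply: (can_inj (mulmxK uPT)).
by rewrite PSP mulmx0 mul0mx.
Qed.

(** * Functions of class C1 in the radial variable *)

Section RadialC1.
Variables (R : realType) (X : topologicalType) (J : set R) (O : set X).
Hypotheses (oJ : open J) (oO : open O).
Implicit Types f g : R -> X -> R.

(** Joint continuity of [f] and of its radial derivative is what is needed to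
    integrate over the cylinder, and it can be checked in charts. The class is
    closed under the rational operations, so that the mean curvature is in it
    as soon as the entries of [G] and of its first radial derivative are: no
    formula for the derivative of an inverse matrix is needed. *)
Definition radial_C1 f : Prop := forall r x, J r -> O x ->
  [/\ derivable (f ^~ x) r 1,
      (fun p : R * X => f p.1 p.2) @ nbhs (r, x) --> f r x
    & (fun p : R * X => derive1 (f ^~ p.2) p.1) @ nbhs (r, x)
        --> derive1 (f ^~ x) r].

Lemma near_rectangle r x : J r -> O x ->
  \forall p \near (r, x), J p.1 /\ O p.2.
Proof.
move=> Jr Ox; exists (J, O) => //=.
by split; [exact: open_nbhs_nbhs | exact: open_nbhs_nbhs].
Qed.

Lemma cvg_rectangle (f g : R * X -> R) r x : J r -> O x ->
  (forall s y, J s -> O y -> f (s, y) = g (s, y)) ->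
  f @ nbhs (r, x) --> f (r, x) -> g @ nbhs (r, x) --> g (r, x).
Proof.
move=> Jr Ox fg; rewrite -(fg r x)//; apply: cvg_trans.
apply: near_eq_cvg; apply: filterS (near_rectangle Jr Ox) => -[s y] /= [Js Oy].
by rewrite fg.
Qed.

Lemma eq_derive1_on (f g : R -> R) r : J r ->
  (forall s, J s -> f s = g s) -> derive1 f r = derive1 g r.
Proof.
move=> Jr fg; rewrite !derive1E; apply: near_eq_derive.
have : nbhs r J by exact: open_nbhs_nbhs.
by apply: filterS => s /fg.
Qed.

Lemma eq_derivable_on (f g : R -> R) r : J r ->
  (forall s, J s -> f s = g s) -> derivable f r 1 -> derivable g r 1.
Proof.
move=> Jr fg; apply: near_eq_derivable.
have : nbhs r J by exact: open_nbhs_nbhs.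
by apply: filterS => s /fg.
Qed.

Lemma eq_radial_C1 f g : (forall r x, J r -> O x -> f r x = g r x) ->
  radial_C1 f -> radial_C1 g.
Proof.
move=> fg Cf r x Jr Ox; have [df cf cdf] := Cf r x Jr Ox; split.
- by apply: eq_derivable_on df => // s Js; exact: fg.
- by apply: (cvg_rectangle (f := fun p => f p.1 p.2)) cf => // s y; exact: fg.
- apply: (cvg_rectangle (f := fun p => derive1 (f ^~ p.2) p.1)) cdf => // s y Js Oy.
  by apply: eq_derive1_on => // t Jt; exact: fg.
Qed.

Lemma radial_C1_cst c : radial_C1 (fun _ _ => c).
Proof.
move=> r x _ _; split; [exact: derivable_cst|exact: cvg_cst|].
under eq_fun do rewrite (derive1_cst c).
by rewrite (derive1_cst c); exact: cvg_cst.
Qed.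

Lemma radial_C1D f g : radial_C1 f -> radial_C1 g ->
  radial_C1 (fun r x => f r x + g r x).
Proof.
move=> Cf Cg.
have dE s y : J s -> O y -> derive1 (fun r => f r y + g r y) s
    = derive1 (f ^~ y) s + derive1 (g ^~ y) s.
  move=> Js Oy; have [df _ _] := Cf s y Js Oy; have [dg _ _] := Cg s y Js Oy.
  by rewrite !derive1E (deriveD df dg).
move=> r x Jr Ox; have [df cf cdf] := Cf r x Jr Ox.
have [dg cg cdg] := Cg r x Jr Ox; split.
- exact: (derivableD df dg).
- exact: cvgD.
- apply: (cvg_rectangle
      (f := fun p => derive1 (f ^~ p.2) p.1 + derive1 (g ^~ p.2) p.1)) => //.
    by move=> s y Js Oy /=; rewrite dE.
  exact: cvgD.
Qed.

Lemma radial_C1M f g : radial_C1 f -> radial_C1 g ->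
  radial_C1 (fun r x => f r x * g r x).
Proof.
move=> Cf Cg.
have dE s y : J s -> O y -> derive1 (fun r => f r y * g r y) s
    = f s y * derive1 (g ^~ y) s + g s y * derive1 (f ^~ y) s.
  move=> Js Oy; have [df _ _] := Cf s y Js Oy; have [dg _ _] := Cg s y Js Oy.
  by rewrite !derive1E (deriveM df dg).
move=> r x Jr Ox; have [df cf cdf] := Cf r x Jr Ox.
have [dg cg cdg] := Cg r x Jr Ox; split.
- exact: (derivableM df dg).
- exact: cvgM.
- apply: (cvg_rectangle (f := fun p => f p.1 p.2 * derive1 (g ^~ p.2) p.1 +
      g p.1 p.2 * derive1 (f ^~ p.2) p.1)) => //.
    by move=> s y Js Oy /=; rewrite dE.
  by apply: cvgD; exact: cvgM.
Qed.

Lemma radial_C1V f : (forall r x, J r -> O x -> f r x != 0) -> radial_C1 f ->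
  radial_C1 (fun r x => (f r x)^-1).
Proof.
move=> f0 Cf.
have dE s y : J s -> O y -> derive1 (fun r => (f r y)^-1) s
    = - (f s y) ^- 2 * derive1 (f ^~ y) s.
  move=> Js Oy; have [df _ _] := Cf s y Js Oy.
  by rewrite !derive1E (deriveV (f0 s y Js Oy) df).
move=> r x Jr Ox; have [df cf cdf] := Cf r x Jr Ox; split.
- exact: (derivableV (f0 r x Jr Ox) df).
- by apply: cvgV => //; exact: f0.
- apply: (cvg_rectangle
      (f := fun p => - (f p.1 p.2) ^- 2 * derive1 (f ^~ p.2) p.1)) => //.
    by move=> s y Js Oy /=; rewrite dE.
  apply: cvgM => //; apply: cvgN; apply: cvgV.
    by rewrite expf_neq0 // f0.
  by rewrite expr2; under eq_fun do rewrite expr2; exact: cvgM.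
Qed.

Lemma radial_C1_sum (I : Type) (s : seq I) (F : I -> R -> X -> R) :
  (forall i, radial_C1 (F i)) -> radial_C1 (fun r x => \sum_(i <- s) F i r x).
Proof.
move=> CF; elim: s => [|i s IH].
  by apply: eq_radial_C1 (radial_C1_cst 0) => r x _ _; rewrite big_nil.
by apply: eq_radial_C1 (radial_C1D (CF i) IH) => r x _ _; rewrite big_cons.
Qed.

Lemma radial_C1_prod (I : Type) (s : seq I) (F : I -> R -> X -> R) :
  (forall i, radial_C1 (F i)) -> radial_C1 (fun r x => \prod_(i <- s) F i r x).
Proof.
move=> CF; elim: s => [|i s IH].
  by apply: eq_radial_C1 (radial_C1_cst 1) => r x _ _; rewrite big_nil.
by apply: eq_radial_C1 (radial_C1M (CF i) IH) => r x _ _; rewrite big_cons.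
Qed.

Lemma radial_C1_det (m : nat) (A : R -> X -> 'M[R]_m) :
  (forall i j, radial_C1 (fun r x => A r x i j)) ->
  radial_C1 (fun r x => \det (A r x)).
Proof.
move=> CA; apply: radial_C1_sum => s.
by apply: radial_C1M; [exact: radial_C1_cst | exact: radial_C1_prod].
Qed.

Lemma radial_C1_mulmx (m n p : nat) (A : R -> X -> 'M[R]_(m, n))
    (B : R -> X -> 'M[R]_(n, p)) :
  (forall i j, radial_C1 (fun r x => A r x i j)) ->
  (forall i j, radial_C1 (fun r x => B r x i j)) ->
  forall i j, radial_C1 (fun r x => (A r x *m B r x) i j).
Proof.
move=> CA CB i j.
apply: eq_radial_C1 (_ : radial_C1 (fun r x => \sum_k A r x i k * B r x k j)).
  by move=> r x _ _; rewrite mxE.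
by apply: radial_C1_sum => k; exact: radial_C1M.
Qed.

Lemma radial_C1_tr (m : nat) (A : R -> X -> 'M[R]_m) :
  (forall i j, radial_C1 (fun r x => A r x i j)) ->
  radial_C1 (fun r x => \tr (A r x)).
Proof. by move=> CA; exact: radial_C1_sum. Qed.

(** By Cramer's rule. *)
Lemma radial_C1_invmx (m : nat) (A : R -> X -> 'M[R]_m) :
  (forall r x, J r -> O x -> A r x \in unitmx) ->
  (forall i j, radial_C1 (fun r x => A r x i j)) ->
  forall i j, radial_C1 (fun r x => invmx (A r x) i j).
Proof.
move=> uA CA i j.
apply: eq_radial_C1 (_ : radial_C1 (fun r x =>
  (\det (A r x))^-1 * ((-1) ^+ (j + i) * \det (row' j (col' i (A r x)))))).
  by move=> r x Jr Ox; rewrite /invmx uA // !mxE.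
apply: radial_C1M.
  apply: radial_C1V; last exact: radial_C1_det.
  by move=> r x Jr Ox; have := uA r x Jr Ox; rewrite unitmxE unitfE.
apply: radial_C1M; first exact: radial_C1_cst.
apply: radial_C1_det => k l.
by apply: eq_radial_C1 (CA (lift j k) (lift i l)) => r x _ _; rewrite !mxE.
Qed.

End RadialC1.

(** * Radial derivatives of smooth functions on a product chart *)

Lemma cvg_mx (T : Type) (R : topologicalType) (m n : nat) (F : set_system T)
    (FF : Filter F) (f : T -> 'M[R]_(m, n)) (l : 'M[R]_(m, n)) :
  (forall i j, (fun t => f t i j) @ F --> l i j) -> f @ F --> l.
Proof.
move=> fl A [P nP sPA] /=; rewrite nbhs_filterE /=.
have : \forall t \near F, forall ij, P ij.1 ij.2 (f t ij.1 ij.2).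
  by apply: filter_forall => ij; exact: fl (nP ij.1 ij.2).
by apply: filterS => t Pt; apply: sPA => i j; exact: (Pt (i, j)).
Qed.

Section ProductChart.
Variables (R : realType) (m : nat).
Implicit Types (r s : R) (y : 'rV[R]_m) (z : 'rV[R]_(1 + m)).

Lemma cyl_point_radius r y : lsubmx (cyl_point r y) ord0 ord0 = r.
Proof. by rewrite row_mxKl mxE. Qed.

Lemma cyl_point_base r y : rsubmx (cyl_point r y) = y.
Proof. by rewrite row_mxKr. Qed.

Lemma cyl_pointK z : cyl_point (lsubmx z ord0 ord0) (rsubmx z) = z.
Proof.
rewrite -[RHS]hsubmxK /cyl_point; congr row_mx.
by apply/matrixP => i j; rewrite mxE !ord1.
Qed.

Lemma cvg_cyl_point (T : Type) (F : set_system T) (FF : Filter F)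
    (f : T -> R) (g : T -> 'rV[R]_m) r y :
  f @ F --> r -> g @ F --> y ->
  (fun t => cyl_point (f t) (g t)) @ F --> cyl_point r y.
Proof.
move=> fr gy; apply: cvg_mx => i j; rewrite ord1.
case: (split_ordP j) => k ->.
  by rewrite /cyl_point row_mxEl mxE; under eq_fun do rewrite row_mxEl mxE.
rewrite /cyl_point row_mxEr; under eq_fun do rewrite row_mxEr.
exact: cvg_comp gy (@coord_continuous _ _ _ ord0 k y).
Qed.

Lemma cyl_point_shift t r y :
  t *: basis_vec R (lshift m ord0) + cyl_point r y = cyl_point (t + r) y.
Proof.
apply/rowP => j; rewrite /cyl_point /basis_vec.
case: (split_ordP j) => k ->.
  by rewrite [LHS]mxE !row_mxEl !mxE !ord1 !eqxx mulr1.
by rewrite [LHS]mxE !row_mxEr !mxE eq_rlshift andbF mulr0 add0r.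
Qed.

Lemma derivable_cyl_point (F : 'rV[R]_(1 + m) -> R) r y :
  derivable F (cyl_point r y) (basis_vec R (lshift m ord0)) =
  derivable (fun s => F (cyl_point s y)) r 1.
Proof.
rewrite /derivable; set u := fun t => t^-1 *: _; set v := fun t => t^-1 *: _.
suff -> : u = v by [].
by apply/funext => t; rewrite /u /v /= cyl_point_shift [t%:A]mulr1.
Qed.

Lemma derive_cyl_point (F : 'rV[R]_(1 + m) -> R) r y :
  'D_(basis_vec R (lshift m ord0)) F (cyl_point r y) =
  derive1 (fun s => F (cyl_point s y)) r.
Proof.
rewrite /derive /derive1; set u := fun t => t^-1 *: _; set v := fun t => t^-1 *: _.
suff -> : u = v by [].
by apply/funext => t; rewrite /u /v /= cyl_point_shift.
Qed.

Variables (N : manifold R m) (a b : \bar R) (c : chart R m N).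

Lemma ioo_open : open (ioo a b).
Proof.
have -> : ioo a b = [set r | (a < r%:E)%E] `&` [set r | (r%:E < b)%E].
  by apply/seteqP; split=> r /=; [move/andP | move=> ?; apply/andP].
by apply: openI; [exact: open_ereal_gt | exact: open_ereal_lt].
Qed.

Lemma near_ioo r : ioo a b r -> \forall s \near r, ioo a b s.
Proof. by move=> ir; apply: open_nbhs_nbhs; split => //; exact: ioo_open. Qed.

Lemma cyl_domain_point r y :
  cyl_domain a b c (cyl_point r y) = (ioo a b r /\ cimage c y).
Proof. by rewrite /cyl_domain /= cyl_point_radius cyl_point_base. Qed.

(** The coordinate [r] is interior, so that the one-sided partial derivative
    in that direction is an honest derivative even at boundary points. *)
Lemma partial_radial (f : 'rV[R]_(1 + m) -> R) r y :
  cyl_domain a b c (cyl_point r y) ->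
  partial (cyl_domain a b c) f (cyl_point r y) (lshift m ord0) =
  derive1 (fun s => f (cyl_point s y)) r.
Proof.
rewrite cyl_domain_point => -[ir iy]; rewrite /partial /derive1.
have dt t : cyl_point r y + t *: basis_vec R (lshift m ord0)
    = cyl_point (t + r) y by rewrite addrC cyl_point_shift.
have -> : (fun t => (f (cyl_point r y + t *: basis_vec R (lshift m ord0)) -
      f (cyl_point r y)) / t) =
    (fun t => t^-1 *: (f (cyl_point (t + r) y) - f (cyl_point r y))).
  by apply/funext => t; rewrite dt mulrC.
have nt : (0 : R)^' [set t | cyl_domain a b c
    (cyl_point r y + t *: basis_vec R (lshift m ord0))].
  have cr : (fun t => t + r) @ nbhs (0 : R) --> r.
    by rewrite -[X in _ --> X]add0r; apply: cvgD; [exact: cvg_id|exact: cvg_cst].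
  have nr : \forall t \near (0 : R), ioo a b (t + r) by exact: cr (near_ioo ir).
  apply: nbhs_dnbhs; apply: filterS nr => t /= it.
  by rewrite dt cyl_domain_point.
congr (lim (_ @ _)); apply/seteqP; split=> A.
  by rewrite /within /=; near_simpl => wA; apply: filterS2 nt wA => t Dt; exact.
by move=> nA; rewrite /within /=; near_simpl; apply: filterS nA.
Qed.

(** A local extension serves at all nearby points of the domain, and its
    radial derivative extends that of [f]. *)
Lemma smooth_on_radial (f : 'rV[R]_(1 + m) -> R) z0 :
  smooth_on (cyl_domain a b c) f -> cyl_domain a b c z0 ->
  exists U F, [/\ open U, U z0, forall k, Ck k U F &
    forall r y, U (cyl_point r y) -> cyl_domain a b c (cyl_point r y) ->
    [/\ f (cyl_point r y) = F (cyl_point r y),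
        derivable (fun s => f (cyl_point s y)) r 1 &
        derive1 (fun s => f (cyl_point s y)) r
          = 'D_(basis_vec R (lshift m ord0)) F (cyl_point r y)]].
Proof.
move=> sf Dz0; have [U [F [oU Uz0 CF fF]]] := sf z0 Dz0.
have near_f r y : U (cyl_point r y) -> cyl_domain a b c (cyl_point r y) ->
    \forall s \near r, f (cyl_point s y) = F (cyl_point s y).
  move=> Uz; rewrite cyl_domain_point => -[ir iy].
  have cy : (fun s => cyl_point s y) @ nbhs r --> cyl_point r y.
    by apply: cvg_cyl_point; [exact: cvg_id | exact: cvg_cst].
  apply: filterS2 (near_ioo ir) (cy _ (open_nbhs_nbhs (conj oU Uz))) => s js Us.
  by apply: fF => //; rewrite cyl_domain_point.
exists U, F; split=> // r y Uz Dz; split; first exact: fF.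
  have [_ /(_ (lshift m ord0))[dF _]] := CF 1%N.
  have := dF _ Uz; rewrite derivable_cyl_point; apply: near_eq_derivable.
  by apply: filterS (near_f r y Uz Dz) => s ->.
rewrite derive_cyl_point !derive1E; apply: near_eq_derive.
by apply: filterS (near_f r y Uz Dz) => s ->.
Qed.

End ProductChart.

Section SmoothRadial.
Variables (R : realType) (m : nat) (N : manifold R m) (a b : \bar R).
Variable c : chart R m N.
Hypothesis ac : atlas c.

Lemma cdom_open : open (cdom c).
Proof. by have [] := atlas_chart ac. Qed.

Lemma cmap_continuous x : cdom c x -> cmap c @ nbhs x --> cmap c x.
Proof.
move=> cx; have [oc _ _ cc _] := atlas_chart ac.
by move: cc; rewrite (continuous_open_subspace _ oc) => /(_ x); apply; rewrite inE.
Qed.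

Lemma cmapK x : cdom c x -> cinv c (cmap c x) = x.
Proof. by have [_ _ + _ _] := atlas_chart ac; apply. Qed.

Lemma cyl_domain_cmap r x : ioo a b r -> cdom c x ->
  cyl_domain a b c (cyl_point r (cmap c x)).
Proof. by move=> ir cx; rewrite cyl_domain_point; split => //; exists x. Qed.

Lemma smooth_radial_C1 (f : 'rV[R]_(1 + m) -> R) :
  smooth_on (cyl_domain a b c) f ->
  radial_C1 (ioo a b) (cdom c) (fun r x => f (cyl_point r (cmap c x))).
Proof.
move=> sf r x ir cx.
have [U [F [oU Uz CF fF]]] := smooth_on_radial sf (cyl_domain_cmap ir cx).
have [fE df dE] := fF _ _ Uz (cyl_domain_cmap ir cx).
have cz : (fun p : R * N => cyl_point p.1 (cmap c p.2)) @ nbhs (r, x)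
    --> cyl_point r (cmap c x).
  apply: cvg_cyl_point; first exact: cvg_fst.
  exact: cvg_comp cvg_snd (cmap_continuous cx).
have near_z : \forall p \near (r, x), [/\ ioo a b p.1, cdom c p.2 &
    U (cyl_point p.1 (cmap c p.2))].
  apply: filterS2 (near_rectangle (@ioo_open R a b) cdom_open ir cx)
    (cz _ (open_nbhs_nbhs (conj oU Uz))) => p [ip cp] Up; split=> //.
split; first exact: df.
  have Fz : (fun p : R * N => F (cyl_point p.1 (cmap c p.2))) @ nbhs (r, x)
      --> F (cyl_point r (cmap c x)).
    exact: cvg_comp cz ((CF 0%N).1 _ Uz).
  rewrite fE; move: Fz; apply: cvg_trans; apply: near_eq_cvg.
  apply: filterS near_z => -[s y] /= [js cy Usy].
  by have [-> _ _] := fF _ _ Usy (cyl_domain_cmap js cy).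
have [_ /(_ (lshift m ord0))[_ [cD _]]] := CF 1%N.
pose F' w := 'D_(basis_vec R (lshift m ord0)) F w.
have Fz : (fun p : R * N => F' (cyl_point p.1 (cmap c p.2))) @ nbhs (r, x)
    --> F' (cyl_point r (cmap c x)).
  exact: cvg_comp cz (cD _ Uz).
rewrite dE; move: Fz; apply: cvg_trans; apply: near_eq_cvg.
apply: filterS near_z => -[s y] /= [js cy Usy].
by have [_ _ ->] := fF _ _ Usy (cyl_domain_cmap js cy).
Qed.

(** This allows a second radial derivative of the metric, which the derivative
    of the mean curvature involves. *)
Lemma smooth_on_radial_derive (f : 'rV[R]_(1 + m) -> R) :
  smooth_on (cyl_domain a b c) f ->
  smooth_on (cyl_domain a b c) (fun z =>
    derive1 (fun s => f (cyl_point s (rsubmx z))) (lsubmx z ord0 ord0)).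
Proof.
move=> sf z Dz; have [U [F [oU Uz CF fF]]] := smooth_on_radial sf Dz.
exists U, (fun w => 'D_(basis_vec R (lshift m ord0)) F w); split=> //.
  by move=> k; have [_ /(_ (lshift m ord0))[]] := CF k.+1.
move=> w Uw Dw; rewrite -[w]cyl_pointK in Uw Dw *.
by have [_ _ <-] := fF _ _ Uw Dw; rewrite cyl_point_base cyl_point_radius.
Qed.

End SmoothRadial.

(** * The radial Ricci curvature and the mean curvature *)

Lemma derive1_sum (R : realType) (n : nat) (f : 'I_n -> R -> R) (r : R) :
  (forall i, derivable (f i) r 1) ->
  derive1 (fun s => \sum_i f i s) r = \sum_i derive1 (f i) r.
Proof.
move=> df; rewrite derive1E.
have -> : (fun s => \sum_i f i s) = \sum_i f i by apply/funext => s; rewrite fct_sumE.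
by rewrite derive_sum //; apply: eq_bigr => i _; rewrite derive1E.
Qed.

Section Weingarten.
Variables (R : realType) (m : nat) (N : manifold R m) (a b : \bar R).
Implicit Types (G : R -> tensor2 N) (c : chart R m N) (x : N).

Definition radial_derivative G r c x : 'M[R]_m :=
  \matrix_(i, j) derive1 (fun s => G s c x i j) r.

Definition weingarten G r c x : 'M[R]_m :=
  2^-1 *: (invmx (G r c x) *m radial_derivative G r c x).

Lemma mean_curvatureE G r x :
  mean_curvature G r x = \tr (weingarten G r (chart_at x) x).
Proof. by rewrite mxtraceZ. Qed.

Lemma near_cyl_domain c z (q : 'I_(1 + m)) : atlas c -> cyl_domain a b c z ->
  \forall t \near (0 : R), 0 < t -> cyl_domain a b c (z + t *: basis_vec R q).
Proof.
move=> /atlas_chart[_ [V oV cV] _ _ _] [iz]; rewrite /= cV => -[Vz hz].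
pose p (t : R) := z + t *: basis_vec R q.
have pz i : (fun t => p t ord0 i) @ nbhs (0 : R) --> z ord0 i.
  rewrite (_ : (fun t => _) = (fun t => z ord0 i + t * basis_vec R q ord0 i)); last first.
    by apply/funext => t; rewrite !mxE.
  rewrite -[X in _ --> X]addr0 -[X in _ --> _ + X](mul0r (basis_vec R q ord0 i)).
  by apply: cvgD; [exact: cvg_cst | apply: cvgMl; exact: cvg_id].
have lz : (fun t => lsubmx (p t) ord0 ord0) @ nbhs (0 : R) --> lsubmx z ord0 ord0.
  by rewrite mxE; under eq_fun do rewrite mxE; exact: pz.
have rz : (fun t => rsubmx (p t)) @ nbhs (0 : R) --> rsubmx z.
  by apply: cvg_mx => i j; rewrite mxE ord1; under eq_fun do rewrite mxE; exact: pz.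
have nl : \forall t \near (0 : R), ioo a b (lsubmx (p t) ord0 ord0).
  exact: lz (near_ioo iz).
have nr : \forall t \near (0 : R), V (rsubmx (p t)).
  exact: rz (open_nbhs_nbhs (conj oV Vz)).
apply: filterS2 nl nr => t it Vt t0.
split => //=; rewrite cV; split => // i i0.
rewrite !mxE; apply: addr_ge0; first by have := hz i i0; rewrite mxE.
by rewrite mulr_ge0 ?ler0n // ltW.
Qed.

(** A point of a half-space can be left along any coordinate direction without
    leaving the half-space, so that the one-sided partial derivative is a limit
    along a proper filter. *)
Lemma partial_cst c (f : 'rV[R]_(1 + m) -> R) k z (q : 'I_(1 + m)) :
  atlas c -> cyl_domain a b c z -> (forall w, cyl_domain a b c w -> f w = k) ->
  partial (cyl_domain a b c) f z q = 0.
Proof.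
move=> ac Dz fk; rewrite /partial.
set D := [set t : R | _]; set u := fun t : R => _.
have properD : ProperFilter (within D (0 : R)^').
  apply: Build_ProperFilter_ex => A /nbhs_ballP[e /= e0 eA].
  have /nbhs_ballP[e' /= e'0 e'D] := near_cyl_domain q ac Dz.
  (* any t > 0 small enough for both neighbourhoods *)
  pose t := Num.min e e' / 2.
  have t0 : 0 < t by rewrite divr_gt0 // lt_min e0.
  have te : t < Num.min e e'.
    by rewrite ltr_pdivrMr // ltr_pMr ?ltr1n // lt_min e0.
  move: te; rewrite lt_min => /andP[te te'].
  exists t; apply: eA; rewrite /ball /= ?sub0r ?normrN ?gtr0_norm ?gt_eqF //.
  by apply: e'D => //; rewrite /ball /= sub0r normrN gtr0_norm.
have u0 : u @ within D (0 : R)^' --> (0 : R).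
  move=> A A0; suff : \forall t \near (0 : R)^', D t -> A (u t) by [].
  apply: nearW => t Dt.
  by rewrite /u (fk _ Dt) (fk _ Dz) subrr mul0r; exact: nbhs_singleton.
exact: cvg_lim u0.
Qed.

Variable c : chart R m N.
Hypothesis ac : atlas c.
Variable G : R -> tensor2 N.

Local Notation D := (cyl_domain a b c).
Local Notation e0 := (lshift m ord0).
Local Notation g := (cyl_metric G c).

(** The components of the metric along [r] are constant, so that only one of
    the three derivatives in the Christoffel symbol survives. *)
Lemma christoffel_radial z l j : D z ->
  christoffel D g z l e0 j =
  2^-1 * \sum_p invmx (g z) l p * partial D (fun y => g y p j) z e0.
Proof.
move=> Dz; congr (_ * _); apply: eq_bigr => p _; congr (_ * _).
have -> : partial D (fun y => g y p e0) z j = 0.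
  apply: (partial_cst (k := (1%:M : 'M[R]_(1 + m)) p e0)) => // w _.
  rewrite /cyl_metric scalar_mx_block.
  by case: (split_ordP p) => k ->; rewrite ?block_mxEul ?block_mxEdl.
have -> : partial D (fun y => g y e0 j) z p = 0.
  apply: (partial_cst (k := (1%:M : 'M[R]_(1 + m)) e0 j)) => // w _.
  rewrite /cyl_metric scalar_mx_block.
  by case: (split_ordP j) => k ->; rewrite ?block_mxEul ?block_mxEur.
by rewrite addr0 subr0.
Qed.

Lemma christoffel_radial_radial z l : D z -> christoffel D g z l e0 e0 = 0.
Proof.
move=> Dz; rewrite christoffel_radial // big1 ?mulr0 // => p _.
rewrite (partial_cst (k := (1%:M : 'M[R]_(1 + m)) p e0)) ?mulr0 // => w _.
rewrite /cyl_metric scalar_mx_block.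
by case: (split_ordP p) => k ->; rewrite ?block_mxEul ?block_mxEdl.
Qed.

Lemma christoffel_weingarten r x l j : ioo a b r -> cdom c x ->
  G r c x \in unitmx ->
  christoffel D g (cyl_point r (cmap c x)) l e0 j =
  (block_mx 0 0 0 (weingarten G r c x) : 'M[R]_(1 + m)) l j.
Proof.
move=> ir cx uG; have Dz := cyl_domain_cmap ir cx.
have gE s : g (cyl_point s (cmap c x)) = block_mx 1%:M 0 0 (G s c x).
  by rewrite /cyl_metric cyl_point_radius cyl_point_base (cmapK ac cx).
rewrite christoffel_radial // gE.
pose dg : 'M[R]_(1 + m) := block_mx 0 0 0 (radial_derivative G r c x).
transitivity ((2^-1 *: (invmx (block_mx 1%:M 0 0 (G r c x)) *m dg)) l j).
  rewrite !mxE; congr (_ * _); apply: eq_bigr => p _; congr (_ * _).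
  rewrite partial_radial //; under eq_fun do rewrite gE.
  rewrite /dg; case: (split_ordP p) => p' ->; case: (split_ordP j) => j' ->.
  - by under eq_fun do rewrite block_mxEul; rewrite block_mxEul derive1_cst mxE.
  - by under eq_fun do rewrite block_mxEur; rewrite block_mxEur derive1_cst mxE.
  - by under eq_fun do rewrite block_mxEdl; rewrite block_mxEdl derive1_cst mxE.
  - by under eq_fun do rewrite block_mxEdr; rewrite block_mxEdr mxE.
rewrite invmx_block_diag; last first.
  by rewrite unitmxE det_ublock det1 mul1r -unitmxE.
by rewrite mulmx_block !(mulmx0, mul0mx, addr0, add0r) scale_block_mx !scaler0.
Qed.

(** The Riccati equation of the shape operator of the level sets, traced. The
    radial curves are geodesics, which kills the other terms of the Ricci
    tensor. *)
Lemma ricci_radial r x : ioo a b r -> cdom c x ->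
  (forall s, ioo a b s -> G s c x \in unitmx) ->
  (forall l, derivable (fun s => weingarten G s c x l l) r 1) ->
  ricci D g (cyl_point r (cmap c x)) e0 e0 =
  - derive1 (fun s => \tr (weingarten G s c x)) r
  - \tr (weingarten G r c x *m weingarten G r c x).
Proof.
move=> ir cx uG dW; have Dz := cyl_domain_cmap ir cx.
rewrite /ricci; congr (_ + _).
  transitivity (- \sum_l derive1 (fun s =>
      (block_mx 0 0 0 (weingarten G s c x) : 'M[R]_(1 + m)) l l) r).
    rewrite -sumrN; apply: eq_bigr => l _.
    rewrite (partial_cst (k := 0)) // => [|w Dw]; last first.
      exact: christoffel_radial_radial.
    rewrite sub0r partial_radial //; congr (- _).
    apply: (eq_derive1_on (@ioo_open R a b) ir) => s js.
    by rewrite christoffel_weingarten // uG.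
  congr (- _); rewrite big_split_ord /= big1 ?add0r => [|l _]; last first.
    by under eq_fun do rewrite block_mxEul mxE; rewrite derive1_cst.
  rewrite derive1_sum //; apply: eq_bigr => l _.
  by under eq_fun do rewrite block_mxEdr.
pose W : 'M[R]_(1 + m) := block_mx 0 0 0 (weingarten G r c x).
transitivity (- \tr (W *m W)).
  rewrite -sumrN; apply: eq_bigr => l _; rewrite mxE -sumrN.
  apply: eq_bigr => p _; rewrite christoffel_radial_radial // mulr0 sub0r.
  by rewrite !christoffel_weingarten // uG.
by rewrite mulmx_block !(mulmx0, mul0mx, addr0, add0r) mxtrace_block mxtrace0 add0r.
Qed.

End Weingarten.

(** * The Riccati identity for the radial mass *)

Section RadialMass.
Variables (R : realType) (m : nat) (N : manifold R m) (a b : \bar R).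
Variables (G : R -> tensor2 N) (h : R -> R).
Hypothesis hG : metric_family a b G.
Hypothesis hsmooth : smooth_fun a b h.
Hypothesis hpos : forall r, ioo a b r -> 0 < h r.

Local Notation J := (ioo a b).

Lemma metric_posdef r c x : J r -> atlas c -> cdom c x -> posdef (G r c x).
Proof. by move=> /hG.1[pG _ _] ac cx; exact: pG. Qed.

Lemma metric_unit r c x : J r -> atlas c -> cdom c x -> G r c x \in unitmx.
Proof. by move=> jr ac cx; exact/posdef_unit/metric_posdef. Qed.

Section Chart.
Variable c : chart R m N.
Hypothesis ac : atlas c.

Lemma cyl_metricE s x i j : cdom c x ->
  cyl_metric G c (cyl_point s (cmap c x)) (rshift 1 i) (rshift 1 j) = G s c x i j.
Proof.
by move=> cx; rewrite /cyl_metric cyl_point_radius cyl_point_base cmapK // block_mxEdr.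
Qed.

Lemma radial_C1_metric i j : radial_C1 J (cdom c) (fun r x => G r c x i j).
Proof.
have := smooth_radial_C1 ac (hG.2 c (rshift 1 i) (rshift 1 j) ac).
apply: eq_radial_C1; [exact: ioo_open|exact: cdom_open|].
by move=> r x _ cx; rewrite cyl_metricE.
Qed.

Lemma radial_C1_metric_derive i j :
  radial_C1 J (cdom c) (fun r x => radial_derivative G r c x i j).
Proof.
have := smooth_radial_C1 ac
  (smooth_on_radial_derive (hG.2 c (rshift 1 i) (rshift 1 j) ac)).
apply: eq_radial_C1; [exact: ioo_open|exact: cdom_open|].
move=> r x _ cx; rewrite [RHS]mxE cyl_point_radius cyl_point_base.
by congr (derive1 _ r); apply/funext => s; rewrite cyl_metricE.
Qed.

Lemma radial_C1_weingarten i j :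
  radial_C1 J (cdom c) (fun r x => weingarten G r c x i j).
Proof.
have oJ := @ioo_open R a b; have oc := cdom_open ac.
have : radial_C1 J (cdom c) (fun r x =>
    2^-1 * (invmx (G r c x) *m radial_derivative G r c x) i j).
  apply: (radial_C1M oJ oc); first exact: radial_C1_cst.
  apply: (radial_C1_mulmx oJ oc) => k l; last exact: radial_C1_metric_derive.
  apply: (radial_C1_invmx oJ oc) => [r x jr cx|i' j']; first exact: metric_unit.
  exact: radial_C1_metric.
by apply: (eq_radial_C1 oJ oc) => r x _ _; rewrite [RHS]mxE.
Qed.

End Chart.

(** The Jacobian of a change of charts of the base does not depend on [r], so
    that [G] and its radial derivative transform by the same congruence. *)
Lemma weingarten_conj r c c' x : J r -> atlas c -> atlas c' ->
  cdom c x -> cdom c' x -> exists2 K, K \in unitmx &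
    weingarten G r c x = invmx K *m weingarten G r c' x *m K.
Proof.
move=> jr ac ac' cx cx'; pose K := (Defs.jacobian c c' x)^T.
have GK s : J s -> G s c x = K^T *m G s c' x *m K.
  by move=> js; have [_ _ tG] := hG.1 s js; rewrite (tG c c') // trmxK.
have uG := metric_unit jr ac cx; have uG' := metric_unit jr ac' cx'.
have uK : K \in unitmx.
  by move: uG; rewrite GK // unitmx_mul => /andP[].
exists K => //.
have dGK : radial_derivative G r c x = K^T *m radial_derivative G r c' x *m K.
  have CG i j : derivable (fun s => G s c' x i j) r 1.
    by have [] := radial_C1_metric ac' i j jr cx'.
  apply/matrixP => i j; rewrite mxE.
  rewrite (eq_derive1_on (@ioo_open R a b) jr
    (g := fun s => \sum_k \sum_l G s c' x l k * (K^T i l * K k j))); last first.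
    move=> s js; rewrite GK // mxE; apply: eq_bigr => k _.
    rewrite [(_ *m _) i k]mxE mulr_suml.
    by apply: eq_bigr => l _; rewrite mulrAC mulrC mulrA.
  have dM k l : derivable (fun s => G s c' x l k * (K^T i l * K k j)) r 1.
    by apply: derivableM; [exact: CG | exact: derivable_cst].
  rewrite derive1_sum => [|k]; last first.
    have := @derivable_sum _ _ _ _ (fun l s => G s c' x l k * (K^T i l * K k j)) r 1
      (dM k).
    by rewrite (_ : \sum_l _ = fun s => \sum_l G s c' x l k * (K^T i l * K k j)) //;
      apply/funext => s; rewrite fct_sumE.
  rewrite [RHS]mxE; apply: eq_bigr => k _; rewrite derive1_sum //.
  rewrite [(_ *m _) i k]mxE mulr_suml; apply: eq_bigr => l _.
  rewrite derive1Mr // [radial_derivative _ _ _ _ l k]mxE.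
  by rewrite mulrCA mulrA.
have uKT : K^T \in unitmx by rewrite unitmx_tr.
rewrite /weingarten -scalemxAr -scalemxAl; congr (_ *: _).
apply: (can_inj (mulKmx uG)); rewrite mulmxA mulmxV // mul1mx dGK GK // !mulmxA.
by rewrite mulmxK // mulmxK.
Qed.

Lemma trace_weingarten r c c' x : J r -> atlas c -> atlas c' ->
  cdom c x -> cdom c' x ->
  \tr (weingarten G r c x) = \tr (weingarten G r c' x).
Proof.
move=> jr ac ac' cx cx'; have [K uK ->] := weingarten_conj jr ac ac' cx cx'.
by rewrite mxtrace_mulC mulmxA mulmxV // mul1mx.
Qed.

Lemma trace_weingarten2 r c c' x : J r -> atlas c -> atlas c' ->
  cdom c x -> cdom c' x ->
  \tr (weingarten G r c x *m weingarten G r c x) =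
  \tr (weingarten G r c' x *m weingarten G r c' x).
Proof.
move=> jr ac ac' cx cx'; have [K uK ->] := weingarten_conj jr ac ac' cx cx'.
rewrite mxtrace_mulC -!mulmxA mulKVmx // mxtrace_mulC -!mulmxA.
by rewrite mulmxV // mulmx1.
Qed.

Lemma radial_C1_atlas (f : R -> N -> R) :
  (forall c, atlas c -> radial_C1 J (cdom c) f) -> radial_C1 J setT f.
Proof.
by move=> Cf r x jr _; apply: (Cf (chart_at x)) => //;
  [exact: chart_at_atlas | exact: mem_chart_at].
Qed.

Lemma radial_C1_mean_curvature : radial_C1 J setT (mean_curvature G).
Proof.
apply: radial_C1_atlas => c ac.
have oJ := @ioo_open R a b; have oc := cdom_open ac.
apply: (eq_radial_C1 oJ oc (f := fun r x => \tr (weingarten G r c x))).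
  move=> r x jr cx; rewrite mean_curvatureE; apply: trace_weingarten => //.
    exact: chart_at_atlas.
  exact: mem_chart_at.
by apply: (radial_C1_tr oJ oc) => i j; exact: radial_C1_weingarten.
Qed.

Lemma radial_C1_weingarten2 : radial_C1 J setT (fun r x =>
  \tr (weingarten G r (chart_at x) x *m weingarten G r (chart_at x) x)).
Proof.
apply: radial_C1_atlas => c ac.
have oJ := @ioo_open R a b; have oc := cdom_open ac.
apply: (eq_radial_C1 oJ oc
  (f := fun r x => \tr (weingarten G r c x *m weingarten G r c x))).
  move=> r x jr cx; apply: trace_weingarten2 => //.
    exact: chart_at_atlas.
  exact: mem_chart_at.
apply: (radial_C1_tr oJ oc) => i j.
by apply: (radial_C1_mulmx oJ oc) => k l; exact: radial_C1_weingarten.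
Qed.

Lemma radial_C1_radius (X : topologicalType) (f : R -> R) :
  (forall r, J r -> derivable f r 1) ->
  (forall r, J r -> derivable (derive1 f) r 1) ->
  radial_C1 J [set: X] (fun r _ => f r).
Proof.
move=> df ddf r x jr _.
have cont (u : R -> R) : derivable u r 1 ->
    (fun p : R * X => u p.1) @ nbhs (r, x) --> u r.
  move=> /derivable1_diffP/differentiable_continuous cu.
  by apply: (@cvg_comp _ _ _ fst u _ (nbhs r)); [exact: cvg_fst | exact: cu].
by split; [exact: df | exact/cont/df | exact/cont/ddf].
Qed.

(** The principal curvature of the level sets in the model. *)
Definition log_derivative r := derive1 h r / h r.
Local Notation kappa := log_derivative.

Lemma radial_C1_h (X : topologicalType) : radial_C1 J [set: X] (fun r _ => h r).
Proof.
by apply: radial_C1_radius => r jr; [exact: (@hsmooth 0%N) | exact: (@hsmooth 1%N)].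
Qed.

Lemma radial_C1_log_derivative (X : topologicalType) :
  radial_C1 J [set: X] (fun r _ => kappa r).
Proof.
have oJ := @ioo_open R a b; apply: (radial_C1M oJ openT).
  by apply: radial_C1_radius => r jr; [exact: (@hsmooth 1%N) | exact: (@hsmooth 2%N)].
by apply: (radial_C1V oJ openT) => [r x jr _|];
  [rewrite gt_eqF // hpos | exact: radial_C1_h].
Qed.

End RadialMass.

Section RiccatiIdentity.
Variables (R : realType) (m : nat) (N : manifold R m) (a b : \bar R).
Variables (h : R -> R) (Ghat : tensor2 N) (G : R -> tensor2 N).
Hypothesis hG : metric_family a b G.
Hypothesis hsmooth : smooth_fun a b h.
Hypothesis hpos : forall r, ioo a b r -> 0 < h r.
Hypothesis hGhat : riemannian Ghat.

Local Notation J := (ioo a b).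
Local Notation kappa := (log_derivative h).
Local Notation oJ := (@ioo_open R a b).

Lemma derivable_h r : J r -> derivable h r 1.
Proof. exact: (@hsmooth 0%N). Qed.

Lemma derivable_log_derivative r : J r -> derivable kappa r 1.
Proof.
move=> jr.
have [dk _ _] := radial_C1_log_derivative hsmooth hpos (X := N) (x := point) jr I.
exact: dk.
Qed.

(** The level sets of a warped metric are umbilic, whatever the metric on the
    base. *)
Lemma weingarten_warped (T : tensor2 N) (G' : R -> tensor2 N) c x r :
  (forall s, J s -> G' s c x = h s ^+ 2 *: T c x) -> T c x \in unitmx ->
  J r -> weingarten G' r c x = (kappa r)%:M.
Proof.
move=> GE uT jr; have h0 : h r != 0 by rewrite gt_eqF // hpos.
have dG : radial_derivative G' r c x = (2 * h r * derive1 h r) *: T c x.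
  apply/matrixP => i j; rewrite !mxE.
  rewrite (eq_derive1_on oJ jr (g := fun s => (h s * h s) * T c x i j)); last first.
    by move=> s js; rewrite GE // mxE expr2.
  have dh := derivable_h jr.
  rewrite derive1Mr; last exact: derivableM.
  by rewrite derive1E (deriveM dh dh) -derive1E /GRing.scale /=; congr (_ * _); ring.
rewrite /weingarten GE // dG invmxZ; last first.
  by rewrite unitmxZ // unitfE expf_neq0.
rewrite -scalemxAl -scalemxAr mulVmx // !scalerA -[RHS]scalemx1; congr (_ *: _).
by rewrite /log_derivative; field.
Qed.

Lemma mean_curvature_warped (T : tensor2 N) (G' : R -> tensor2 N) r x :
  (forall s, J s -> G' s (chart_at x) x = h s ^+ 2 *: T (chart_at x) x) ->
  T (chart_at x) x \in unitmx -> J r ->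
  mean_curvature G' r x = kappa r *+ m.
Proof.
by move=> GE uT jr; rewrite mean_curvatureE (weingarten_warped GE) // mxtrace_scalar.
Qed.

Lemma ricci_rr_warped (T : tensor2 N) (G' : R -> tensor2 N) r x :
  (forall s, J s -> G' s (chart_at x) x = h s ^+ 2 *: T (chart_at x) x) ->
  T (chart_at x) x \in unitmx -> J r ->
  ricci_rr a b G' r x = - (derive1 kappa r + kappa r ^+ 2) *+ m.
Proof.
move=> GE uT jr; have ac := @chart_at_atlas _ _ N x; have cx := mem_chart_at x.
have WE s : J s -> weingarten G' s (chart_at x) x = (kappa s)%:M.
  by move=> js; exact: weingarten_warped GE _ _.
have dk := derivable_log_derivative jr.
rewrite /ricci_rr ricci_radial // => [|s js|l]; first last.
- apply: (eq_derivable_on oJ jr (f := kappa)) => // s js.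
  by rewrite WE // mxE eqxx mulr1n.
- by rewrite GE // unitmxZ // unitfE expf_neq0 // gt_eqF // hpos.
rewrite WE // -scalar_mxM mxtrace_scalar.
rewrite (eq_derive1_on oJ jr (g := fun s => kappa s * m%:R)); last first.
  by move=> s js; rewrite WE // mxtrace_scalar mulr_natr.
by rewrite derive1Mr // mulr_natr -expr2 opprD mulrnDl !mulNrn.
Qed.

Lemma ricci_rrE r x : J r ->
  ricci_rr a b G r x = - derive1 (mean_curvature G ^~ x) r
    - \tr (weingarten G r (chart_at x) x *m weingarten G r (chart_at x) x).
Proof.
move=> jr; have ac := @chart_at_atlas _ _ N x; have cx := mem_chart_at x.
rewrite /ricci_rr ricci_radial // => [|s js|l].
- by congr (- derive1 _ r - _); apply/funext => s; rewrite mean_curvatureE.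
- exact: (metric_unit hG).
- have [dW _ _] := radial_C1_weingarten hG ac l l jr cx; exact: dW.
Qed.

(** The operator [A] compares the shape operators of [G] and of the model. As
    it is self-adjoint for [G], the trace of its square is the square of its
    norm. *)
Definition shape_defect r (x : N) : R :=
  let A := weingarten G r (chart_at x) x - (kappa r)%:M in
  h r ^+ 2 * \tr (A *m A).

Lemma shape_defectE r x : shape_defect r x = h r ^+ 2 *
  (\tr (weingarten G r (chart_at x) x *m weingarten G r (chart_at x) x)
   - 2 * kappa r * mean_curvature G r x + kappa r ^+ 2 *+ m).
Proof.
rewrite /shape_defect mean_curvatureE; set W := weingarten _ _ _ _.
rewrite mulmxBl !mulmxBr mul_scalar_mx mul_mx_scalar -scalar_mxM.
rewrite !linearB /= !linearZ /= mxtrace_scalar -expr2.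
by congr (_ * _); rewrite /GRing.scale /=; ring.
Qed.

Lemma radial_massE r x : J r ->
  radial_mass h Ghat G r x = h r ^+ 2 * (kappa r *+ m - mean_curvature G r x).
Proof.
move=> jr; rewrite /radial_mass (mean_curvature_warped (T := Ghat)) //.
have [pG _ _] := hGhat; apply: posdef_unit; apply: pG.
  exact: chart_at_atlas.
exact: mem_chart_at.
Qed.

Lemma radial_C1_radial_mass : radial_C1 J setT (radial_mass h Ghat G).
Proof.
apply: (eq_radial_C1 oJ openT (f := fun r x =>
  (h r * h r) * (kappa r * m%:R + (-1) * mean_curvature G r x))).
  by move=> r x jr _; rewrite radial_massE // expr2 mulr_natr mulN1r.
have Ch := radial_C1_h hsmooth (X := N).
have Ck := radial_C1_log_derivative hsmooth hpos (X := N).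
apply: (radial_C1M oJ openT); first exact: (radial_C1M oJ openT).
apply: (radial_C1D oJ openT).
  by apply: (radial_C1M oJ openT) => //; exact: radial_C1_cst.
apply: (radial_C1M oJ openT); first exact: radial_C1_cst.
exact: radial_C1_mean_curvature.
Qed.

Lemma radial_C1_shape_defect : radial_C1 J setT shape_defect.
Proof.
apply: (eq_radial_C1 oJ openT (f := fun r x => (h r * h r) *
  (\tr (weingarten G r (chart_at x) x *m weingarten G r (chart_at x) x)
   + (-2 * kappa r * mean_curvature G r x + kappa r * kappa r * m%:R)))).
  move=> r x jr _; rewrite shape_defectE -!expr2 mulr_natr.
  by congr (_ * _); ring.
have Ch := radial_C1_h hsmooth (X := N).
have Ck := radial_C1_log_derivative hsmooth hpos (X := N).
apply: (radial_C1M oJ openT); first exact: (radial_C1M oJ openT).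
apply: (radial_C1D oJ openT); first exact: radial_C1_weingarten2.
apply: (radial_C1D oJ openT).
  apply: (radial_C1M oJ openT); last exact: radial_C1_mean_curvature.
  by apply: (radial_C1M oJ openT) => //; exact: radial_C1_cst.
apply: (radial_C1M oJ openT); last exact: radial_C1_cst.
exact: (radial_C1M oJ openT).
Qed.

(** Completing the square in the Riccati equations of [G] and of the model: the
    terms that are linear in the difference of the mean curvatures are absorbed
    by the derivative of the weight [h ^+ 2]. *)
Lemma ricci_excessE r x : J r ->
  ricci_excess a b h Ghat G (r, x) =
  derive1 (radial_mass h Ghat G ^~ x) r - shape_defect r x.
Proof.
move=> jr; have h0 : h r != 0 by rewrite gt_eqF // hpos.
have [dH _ _] := radial_C1_mean_curvature hG jr (I : [set: N] x).
have dh := derivable_h jr; have dk := derivable_log_derivative jr.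
rewrite /ricci_excess /= (ricci_rr_warped (T := Ghat) (G' := warped h Ghat)) //; last first.
  have [pG _ _] := hGhat; apply: posdef_unit; apply: pG.
    exact: chart_at_atlas.
  exact: mem_chart_at.
rewrite ricci_rrE // shape_defectE.
rewrite (eq_derive1_on oJ jr (f := radial_mass h Ghat G ^~ x) (g := fun s =>
  (h s * h s) * (kappa s * m%:R - mean_curvature G s x))); last first.
  by move=> s js; rewrite radial_massE // expr2 mulr_natr.
have dkm : derivable (fun s => kappa s * m%:R) r 1.
  by apply: derivableM; [exact: dk|exact: derivable_cst].
have dhh : derivable (fun s => h s * h s) r 1 by exact: (derivableM dh dh).
have -> : derive1 (fun s => (h s * h s) * (kappa s * m%:R - mean_curvature G s x)) r =
  h r * h r * (derive1 kappa r * m%:R - derive1 (mean_curvature G ^~ x) r) +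
  (kappa r * m%:R - mean_curvature G r x) * (2 * h r * derive1 h r).
  rewrite derive1E (deriveM dhh (derivableB dkm dH)) (deriveB dkm dH) (deriveM dh dh).
  have -> : 'D_1 (fun s => kappa s * m%:R) r = derive1 kappa r * m%:R.
    by rewrite -derive1E; exact: (derive1Mr (f := kappa) m%:R dk).
  rewrite -!derive1E; congr (_ + _ * _); rewrite /GRing.scale /=.
  by move: (h r) (derive1 h r) => s s'; ring.
have -> : derive1 h r = kappa r * h r by rewrite /log_derivative divfK.
rewrite -(mulr_natr (- _) m) -(mulr_natr (_ ^+ 2) m).
move: (derive1 kappa r) (derive1 _ r) (kappa r) (mean_curvature G r x) (\tr _) (h r).
move=> k' H' k H T s; ring.
Qed.

Lemma shape_operatorE r x : J r ->
  weingarten G r (chart_at x) x - (kappa r)%:M = invmx (G r (chart_at x) x) *m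
    (2^-1 *: radial_derivative G r (chart_at x) x - kappa r *: G r (chart_at x) x).
Proof.
move=> jr; rewrite mulmxBr -!scalemxAr mulVmx ?scalemx1 //.
by apply: (metric_unit hG jr); [exact: chart_at_atlas|exact: mem_chart_at].
Qed.

(** The tensor [S] is symmetric because [G] is; the transpose gives the trace
    the form of a squared norm. *)
Lemma shape_defect_trace r x (S : 'M[R]_m := 2^-1 *: radial_derivative G r (chart_at x) x
    - kappa r *: G r (chart_at x) x) : J r ->
  shape_defect r x = h r ^+ 2 * \tr (invmx (G r (chart_at x) x) *m S *m
    invmx (G r (chart_at x) x) *m S^T).
Proof.
move=> jr; have ac := @chart_at_atlas _ _ N x; have cx := mem_chart_at x.
have symG s : J s -> (G s (chart_at x) x)^T = G s (chart_at x) x.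
  by move=> js; have [] := metric_posdef hG js ac cx.
suff -> : S^T = S by rewrite /shape_defect shape_operatorE // !mulmxA.
have symdG : (radial_derivative G r (chart_at x) x)^T =
    radial_derivative G r (chart_at x) x.
  apply/matrixP => i j; rewrite !mxE; apply: (eq_derive1_on oJ jr) => s js.
  by rewrite -[in RHS]symG // mxE.
by rewrite /S linearB !linearZ /= symG // symdG.
Qed.

Lemma shape_defect_ge0 r x : J r -> 0 <= shape_defect r x.
Proof.
move=> jr; rewrite shape_defect_trace // mulr_ge0 ?sqr_ge0 //.
apply: trace_norm_ge0; apply: (metric_posdef hG jr).
  exact: chart_at_atlas.
exact: mem_chart_at.
Qed.

Lemma shape_defect_eq0 r x : J r -> shape_defect r x = 0 ->
  radial_derivative G r (chart_at x) x = (2 * kappa r) *: G r (chart_at x) x.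
Proof.
move=> jr; rewrite shape_defect_trace // => /eqP.
rewrite mulf_eq0 expf_eq0 gt_eqF ?hpos //= => /eqP /trace_norm_eq0 S0.
have {S0} : 2^-1 *: radial_derivative G r (chart_at x) x =
    kappa r *: G r (chart_at x) x.
  apply/eqP; rewrite -subr_eq0; apply/eqP/S0; apply: (metric_posdef hG jr).
    exact: chart_at_atlas.
  exact: mem_chart_at.
by move=> /(congr1 (fun A => 2 *: A)); rewrite !scalerA mulfV ?pnatr_eq0 // scale1r.
Qed.

End RiccatiIdentity.

(** * Iterated Lebesgue integrals over cubes *)

(** The integral of a nonnegative function is a supremum over simple functions,
    hence monotone also on functions that are not known to be measurable. *)
Lemma integral_monotone d (T : measurableType d) (R : realType)
    (mu : {measure set T -> \bar R}) (f g : T -> \bar R) :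
  (forall x, 0 <= f x)%E -> (forall x, f x <= g x)%E ->
  (\int[mu]_x f x <= \int[mu]_x g x)%E.
Proof.
move=> f0 fg; have g0 x : (0 <= g x)%E by exact: le_trans (f0 x) (fg x).
rewrite !ge0_integralTE //; apply: ereal_sup_le => _ [k /= kf <-].
by exists k => //= x; exact: le_trans (kf x) (fg x).
Qed.

Section Cubes.
Variable R : realType.

Lemma lebesgue_integral_rV_ge0 (d : nat) (f : 'rV[R]_d -> \bar R) :
  (forall y, 0 <= f y)%E -> (0 <= lebesgue_integral_rV f)%E.
Proof.
elim: d f => [|d IH] f f0 /=; first exact: f0.
by apply: integral_ge0 => t _; apply: IH => y; exact: f0.
Qed.

Lemma lebesgue_integral_rV_monotone (d : nat) (f g : 'rV[R]_d -> \bar R) :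
  (forall y, 0 <= f y)%E -> (forall y, f y <= g y)%E ->
  (lebesgue_integral_rV f <= lebesgue_integral_rV g)%E.
Proof.
elim: d f g => [|d IH] f g f0 fg /=; first exact: fg.
apply: integral_monotone => t.
  by apply: lebesgue_integral_rV_ge0 => y; exact: f0.
by apply: IH => y; [exact: f0 | exact: fg].
Qed.

(** The cube is given by its lowest corner so that, at a point of a half-space,
    the cube with this corner stays in the half-space. *)
Definition cube (d : nat) (l : 'rV[R]_d) (s : R) : set 'rV[R]_d :=
  [set y | forall i, l ord0 i <= y ord0 i <= l ord0 i + s].

Lemma lebesgue_integral_cube (d : nat) (l : 'rV[R]_d) (s k : R) : 0 <= s ->
  lebesgue_integral_rV (fun y => (k * \1_(cube l s) y)%:E) = (k * s ^+ d)%:E.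
Proof.
move=> s0; elim: d k l => [|d IH] k l.
  rewrite /= indicE (_ : (_ \in _) = true) ?expr0 //.
  by apply/mem_set => -[].
pose t0 := l ord0 ord0; pose l' : 'rV[R]_d := @rsubmx _ 1 1 d l.
pose row t (y : 'rV[R]_d) : 'rV[R]_d.+1 := row_mx (const_mx t : 'rV[R]_1) y.
have row0 t y : row t y ord0 ord0 = t.
  have -> : ord0 = lshift d ord0 :> 'I_(1 + d) by exact: val_inj.
  have := row_mxEl (const_mx t : 'rV[R]_1) y ord0 ord0.
  by rewrite [X in _ = X -> _]mxE.
have rowS t y (i : 'I_d) : row t y ord0 (@rshift 1 d i) = y ord0 i.
  exact: row_mxEr.
have cubeE t y : \1_(cube l s) (row t y) =
    \1_`[t0, t0 + s]%classic t * \1_(cube l' s) y :> R.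
  rewrite !indicE -natrM mulnb; congr ((nat_of_bool _)%:R).
  apply/idP/andP => [/set_mem H|[/set_mem /= Ht /set_mem Hy]].
    split; apply/mem_set => /=.
      by have := H ord0; rewrite row0 in_itv.
    by move=> i; have := H (@rshift 1 d i); rewrite rowS /l' mxE.
  apply/mem_set => i; case: (@split_ordP 1 d i) => j ->; last first.
    by rewrite rowS; have := Hy j; rewrite /l' mxE.
  have -> : lshift d j = ord0 by rewrite ord1; exact: val_inj.
  by rewrite row0; move: Ht; rewrite in_itv.
rewrite /=.
under eq_integral => t _.
  rewrite (_ : (fun y => _) = (fun y : 'rV[R]_d =>
    (k * \1_`[t0, t0 + s]%classic t * \1_(cube l' s) y)%:E)); last first.
    by apply/funext => y; rewrite -/(row t y) cubeE mulrA.
  rewrite IH mulrAC EFinM.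
  over.
rewrite integralZl //=; last first.
  by apply/integrable_indic_itv.
have mI : (@lebesgue_measure R) `[t0, t0 + s]%classic = s%:E.
  rewrite lebesgue_measure_itv /= lte_fin ltrDl -EFinB addrAC subrr add0r.
  by case: ltgtP s0 => // <-.
rewrite integral_indic // setIT exprSr mulrA [RHS]EFinM.
by congr (_ * _)%E; exact: mI.
Qed.

End Cubes.

(** * The Riemannian measure of a compact manifold *)

Lemma det_posdef (R : realType) (m : nat) (A : 'M[R]_m) : posdef A -> 0 < \det A.
Proof.
move=> /posdef_orthonormalize[P uP] /(congr1 determinant).
rewrite !det_mulmx det_tr det1 mulrAC -expr2 => PA.
have P0 : 0 < \det P ^+ 2.
  by rewrite lt_neqAle sqr_ge0 eq_sym expf_neq0 // -unitfE -unitmxE.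
by rewrite -(pmulr_rgt0 _ P0) PA.
Qed.

Lemma cvg_det (T : Type) (F : set_system T) (FF : Filter F) (R : realType)
    (m : nat) (A : T -> 'M[R]_m) (L : 'M[R]_m) :
  (forall i j, (fun t => A t i j) @ F --> L i j) ->
  (fun t => \det (A t)) @ F --> \det L.
Proof.
move=> AL; have sumP (I : Type) (s : seq I) (f : I -> T -> R) (l : I -> R) :
    (forall i, f i @ F --> l i) ->
    (fun t => \sum_(i <- s) f i t) @ F --> \sum_(i <- s) l i.
  move=> fl; elim: s => [|i s IH].
    by rewrite big_nil; under eq_fun do rewrite big_nil; exact: cvg_cst.
  by rewrite big_cons; under eq_fun do rewrite big_cons; exact: cvgD.
have prodP (I : Type) (s : seq I) (f : I -> T -> R) (l : I -> R) :
    (forall i, f i @ F --> l i) ->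
    (fun t => \prod_(i <- s) f i t) @ F --> \prod_(i <- s) l i.
  move=> fl; elim: s => [|i s IH].
    by rewrite big_nil; under eq_fun do rewrite big_nil; exact: cvg_cst.
  by rewrite big_cons; under eq_fun do rewrite big_cons; exact: cvgM.
apply: (sumP _ _ (fun (s : {perm 'I_m}) t => (-1) ^+ s * \prod_i A t i (s i))) => s.
by apply: cvgM; [exact: cvg_cst | exact: prodP].
Qed.

Section RiemannianMeasure.
Variables (R : realType) (m : nat) (N : manifold R m) (T : tensor2 N).
Hypothesis hT : riemannian T.

Local Notation density c := (fun y => Num.sqrt (\det (T c (cinv c y)))).

(** The components of [T] are only smooth on the image of the chart, which is
    not open near a boundary point: hence the limit within this image. *)
Lemma cvg_density c x : atlas c -> cdom c x ->
  (fun y => \det (T c (cinv c y))) @ within (cimage c) (nbhs (cmap c x))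
    --> \det (T c x).
Proof.
move=> ac cx; apply: cvg_det => i j; have [_ sT _] := hT.
have iy : cimage c (cmap c x) by exists x.
have [U [F [oU Uy CF TF]]] := sT c i j ac _ iy.
have /= := TF _ Uy iy; rewrite cmapK // => ->.
have Fy : F @ within (cimage c) (nbhs (cmap c x)) --> F (cmap c x).
  exact: cvg_within_filter ((CF 0%N).1 _ Uy).
move: Fy; apply: cvg_trans; apply: near_eq_cvg.
rewrite /within /=; near_simpl.
by apply: filterS (open_nbhs_nbhs (conj oU Uy)) => y Uy' iy'; rewrite TF.
Qed.

Lemma density_bounds c x : atlas c -> cdom c x ->
  exists k K : R, [/\ 0 < k, 0 < K & \forall y \near cmap c x, cimage c y ->
    k <= Num.sqrt (\det (T c (cinv c y))) <= K].
Proof.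
move=> ac cx; have [/(_ c x ac cx) pT _ _] := hT.
have d0 := det_posdef pT; set d := \det _ in d0.
(* near x the determinant stays between half and twice its value d at x *)
exists (Num.sqrt (d / 2)), (Num.sqrt (d + d)); split.
- by rewrite sqrtr_gt0 divr_gt0.
- by rewrite sqrtr_gt0 addr_gt0.
have nd : \forall y \near cmap c x, cimage c y ->
    `|d - \det (T c (cinv c y))| < d / 2.
  have := @cvgr_dist_lt _ _ _ _ _ _ _ (cvg_density ac cx) (d / 2).
  move/(_ (within_filter _ (nbhs_filter _))); apply.
  by rewrite divr_gt0.
apply: filterS nd => y dy /dy; rewrite ltr_norml => /andP[l u].
by apply/andP; split; apply: ler_wsqrtr; lra.
Qed.

Variable mu : {measure set (borel N) -> \bar R}.
Hypothesis hmu : riemannian_measure T mu.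

Lemma borel_open (A : set N) : open A -> measurable (A : set (borel N)).
Proof. by move=> oA; exact: sub_sigma_algebra. Qed.

(** A small enough neighbourhood lies in a cube on which the density is
    bounded. *)
Lemma riemannian_measure_locally_finite (x : N) :
  exists A : set N, [/\ open A, A x & (mu A < +oo)%E].
Proof.
set c := chart_at x; have ac : atlas c := @chart_at_atlas _ _ _ x.
have cx : cdom c x := mem_chart_at x.
have [k [K [_ K0 /nbhs_ballP[e /= e0 bound]]]] := density_bounds ac cx.
pose B := cdom c `&` cmap c @^-1` ball (cmap c x) e.
have nB : nbhs x B.
  apply: filterI; first by exact: open_nbhs_nbhs (conj (cdom_open ac) cx).
  have nb := nbhsx_ballx (cmap c x) e e0; exact: (cmap_continuous ac cx nb).
exists B°; split; [exact: open_interior | exact: nB |].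
have sBc : B° `<=` cdom c by move=> z /interior_subset[].
rewrite (hmu ac (borel_open (@open_interior _ B)) sBc).
pose l := cmap c x - const_mx e.
apply: (@le_lt_trans _ _ (K * (e + e) ^+ m)%:E); last exact: ltry.
rewrite -(lebesgue_integral_cube l); last by rewrite addr_ge0 // ltW.
apply: lebesgue_integral_rV_monotone => y; rewrite lee_fin.
  by rewrite mulr_ge0 // sqrtr_ge0.
rewrite !indicE; case: (boolP (y \in cmap c @` B°)) => [|_]; last first.
  by rewrite mul0r mulr_ge0 // ltW.
move=> /set_mem[z Bz zy]; have [cz bz] := interior_subset Bz.
rewrite mul1r mem_set ?mulr1.
  have /andP[_] := bound _ bz (ex_intro2 _ _ z cz erefl).
  by rewrite zy.
move=> i; rewrite -zy !mxE; case: bz => _ /(_ ord0 i).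
rewrite /ball /= ltr_norml => /andP[]; lra.
Qed.

Lemma riemannian_measure_finite : compact [set: N] -> (mu setT < +oo)%E.
Proof.
rewrite compact_cover => cN.
have [A AP] := choice riemannian_measure_locally_finite.
have [||D _ cov] := cN _ [set: N] A.
- by move=> x _; have [] := AP x.
- by move=> x _; exists x => //; have [] := AP x.
suff H (s : seq N) : exists B : set (borel N), [/\ measurable B,
    (mu B < +oo)%E & forall x, x \in s -> A x `<=` B].
  have [B [mB fB sB]] := H (finmap.enum_fset D); apply: le_lt_trans fB.
  apply: le_measure; rewrite ?inE //.
  by move=> z _; have [x Dx Az] := cov z I; exact: sB Dx z Az.
elim: s => [|x s [B [mB fB sB]]].
  by exists set0; split => //; rewrite measure0.
have [oA _ fA] := AP x; have mA := borel_open oA.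
exists (A x `|` B); split; first exact: measurableU.
  apply: (le_lt_trans (measureU2 mu mA mB)); exact: lte_add_pinfty.
move=> z; rewrite inE => /orP[/eqP -> w Aw|/sB AB w Aw]; first by left.
by right; exact: AB.
Qed.

(** The image of [U] in a chart contains a cube with a corner at the chosen
    point, on which the density is bounded below. *)
Lemma riemannian_measure_open_gt0 (U : set N) : open U -> U !=set0 ->
  (0 < mu U)%E.
Proof.
move=> oU [x Ux]; set c := chart_at x.
have ac : atlas c := @chart_at_atlas _ _ _ x.
have cx : cdom c x := mem_chart_at x.
have [_ [V oV cV] _ _ ci] := atlas_chart ac.
have iy : cimage c (cmap c x) by exists x.
pose U' := U `&` cdom c; have oU' : open U' := openI oU (cdom_open ac).
have nU' : \forall y \near cmap c x, cimage c y -> U' (cinv c y).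
  move/subspace_continuousP : ci => /(_ _ iy); rewrite /from_subspace cmapK //.
  have nU : nbhs x U' by apply: open_nbhs_nbhs; split => //; split.
  by move=> cv; exact: cv nU.
have nV : nbhs (cmap c x) V.
  by apply: open_nbhs_nbhs; split => //; move: iy; rewrite cV => -[].
have [k [K [k0 _ nk]]] := density_bounds ac cx.
have [e /= e0 be] := (nbhs_ballP _ _).1 (filterI (filterI nU' nV) nk).
have sU'c : U' `<=` cdom c by move=> z [].
have mU' := borel_open oU'; have mU := borel_open oU.
have lower : ((k * (e / 2) ^+ m)%:E <= mu U')%E.
  rewrite (hmu ac mU' sU'c) -(lebesgue_integral_cube (cmap c x)); last first.
    by rewrite divr_ge0 // ltW.
  apply: lebesgue_integral_rV_monotone => y; rewrite lee_fin.
    by rewrite mulr_ge0 // ltW.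
  rewrite !indicE; case: (boolP (y \in cube _ _)) => [|_]; last first.
    by rewrite mulr0 mulr_ge0 // sqrtr_ge0.
  move=> /set_mem cy.
  have by_ : ball (cmap c x) e y.
    split=> // i j; rewrite ord1 /ball /= distrC.
    have /andP[l u] := cy j; rewrite ger0_norm ?subr_ge0 //.
    by rewrite ltrBlDl (le_lt_trans u) // ltrD2l gtr_pMr // invf_lt1 // ltr1n.
  have [[Uy Vy] ky] := be _ by_.
  have iy' : cimage c y.
    rewrite cV; split => // i i0; have /andP[l _] := cy i.
    by apply: le_trans l; move: iy; rewrite cV => -[_]; exact.
  rewrite mulr1 mem_set ?mul1r; first by have /andP[] := ky iy'.
  exists (cinv c y); first exact: Uy.
  by case: iy' => z cz <-; rewrite cmapK.
apply: lt_le_trans (_ : (mu U' <= mu U)%E).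
  apply: lt_le_trans lower.
  by rewrite lte_fin mulr_gt0 // exprn_gt0 // divr_gt0.
by apply: le_measure; rewrite ?inE // => z [].
Qed.

End RiemannianMeasure.

(** * Integration of continuous functions on a cylinder *)

Lemma cvg_slice_r (X Y : topologicalType) (x : X) (y : Y) :
  (fun z => (x, z)) @ nbhs y --> nbhs (x, y).
Proof.
move=> A [[P Q] /= [nP nQ] PQ]; apply: filterS nQ => z Qz.
by apply: PQ; split => //=; exact: nbhs_singleton.
Qed.

Lemma cvg_slice_l (X Y : topologicalType) (x : X) (y : Y) :
  (fun z => (z, y)) @ nbhs x --> nbhs (x, y).
Proof.
move=> A [[P Q] /= [nP nQ] PQ]; apply: filterS nP => z Pz.
by apply: PQ; split => //=; exact: nbhs_singleton.
Qed.

Section CylinderIntegral.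
Variables (R : realType) (m : nat) (N : manifold R m) (a b : \bar R).
Hypothesis cN : compact [set: N].
Variable mu : {sigma_finite_measure set (borel N) -> \bar R}.
Hypothesis mu_finite : (mu setT < +oo)%E.

Local Notation J := (ioo a b).
Local Notation leb := (@lebesgue_measure R).
Local Notation cylinder := (measurableTypeR R * borel N)%type.

(** Only the second factor needs a countable basis: an open set is the union,
    over the basic open sets [B], of the largest open rectangle with base [B]
    that it contains. *)
Lemma open_prod_measurable (O : set (R * N)) : open O -> measurable (O : set cylinder).
Proof.
move=> oO; have [B cB [Bo Bx]] := @manifold_second_countable _ _ N.
case/pfcard_geP: cB => [B0|[f]].
  have [V [BV _] _] := Bx (point : N) setT filterT.
  by move: BV; rewrite B0.
have fB k : B (f k) by exact: funS.
pose U k : set R := [set s | forall x, f k x -> O (s, x)]°.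
have -> : (O : set cylinder) = \bigcup_k (U k `*` f k).
  apply/seteqP; split => [[r x] Orx|[r x] [k _ [/= Ur fx]]]; last first.
    exact: (interior_subset Ur).
  (* shrinking the second side of a product neighbourhood to a basic open set *)
  have [[A C] /= [nA nC] AC] : nbhs (r, x) O by exact: open_nbhs_nbhs.
  have [V [BV Vx] VC] := Bx x C nC.
  have [k _ fk] := @surj _ _ _ _ f _ BV; exists k => //; split; rewrite /= /U fk //.
  by apply: filterS nA => s As y Vy; apply: AC; split => //=; exact: VC.
apply: bigcupT_measurable => k; apply: measurableX.
  by apply: open_measurable; exact: open_interior.
by apply: borel_open; exact: Bo.
Qed.

Lemma ioo_measurable : measurable (J : set (measurableTypeR R)).
Proof. by apply: open_measurable; exact: ioo_open. Qed.

Lemma continuous_cylinder_measurable (f : R * N -> R) :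
  (forall r x, J r -> f @ nbhs (r, x) --> f (r, x)) ->
  measurable_fun (J `*` setT : set cylinder) f.
Proof.
move=> cf; apply: (measurability _ (RGenOpens.measurableE R)).
move=> _ [_ [u [v ->] <-]]; apply: open_prod_measurable.
rewrite openE => -[r x] [[/= jr _] fuv]; rewrite /interior.
have nJ : \forall p \near (r, x), (J `*` [set: N]) p.
  by apply: filterS (near_rectangle (@ioo_open R a b) openT jr I) => p [].
have nf : \forall p \near (r, x), `]u, v[%classic (f p).
  by apply: cf jr _ _; apply: open_nbhs_nbhs; split => //; exact: interval_open.
exact: filterS2 nJ nf.
Qed.

Lemma continuous_borel_measurable (f : N -> R) :
  continuous f -> measurable_fun setT (f : borel N -> R).
Proof.
move=> cf; apply: (measurability _ (RGenOpens.measurableE R)).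
move=> _ [_ [u [v ->] <-]]; apply: borel_open; rewrite setTI.
by apply: open_comp => [x _|]; [exact: cf | exact: interval_open].
Qed.

Lemma continuous_cylinder_bounded (f : R * N -> R) u v :
  (forall r x, J r -> f @ nbhs (r, x) --> f (r, x)) ->
  `[u, v]%classic `<=` J ->
  exists C, forall r x, u <= r <= v -> `|f (r, x)| <= C.
Proof.
move=> cf uvJ; pose K : set (R * N) := `[u, v]%classic `*` setT.
have /compact_bounded[C [_ HC]] : compact (f @` K).
  apply: continuous_compact.
    apply: continuous_in_subspaceT => -[r x]; rewrite inE => -[/= ruv _].
    exact/cf/uvJ.
  by apply: compact_setX => //; exact: segment_compact.
exists (C + 1) => r x ruv; apply: HC; first by rewrite ltrDl.
by exists (r, x) => //; split=> //=; rewrite in_itv.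
Qed.

Lemma strip_measurable u v : measurable (`[u, v]%classic `*` setT : set cylinder).
Proof. by apply: measurableX => //; exact: measurable_itv. Qed.

Lemma continuous_strip_integrable (f : R * N -> R) u v :
  (forall r x, J r -> f @ nbhs (r, x) --> f (r, x)) ->
  `[u, v]%classic `<=` J ->
  (leb \x mu)%E.-integrable (`[u, v]%classic `*` setT : set cylinder) (EFin \o f).
Proof.
move=> cf uvJ; apply: measurable_bounded_integrable.
- exact: strip_measurable.
- have E : (leb \x mu)%E (`[u, v]%classic `*` setT : set cylinder)
      = (leb `[u, v]%classic * mu setT)%E.
    by apply: product_measure1E => //; exact: measurable_itv.
  rewrite [X in (X < _)%E]E lte_mul_pinfty ?ge0_fin_numE //.
    by rewrite lebesgue_measure_itv; case: ifP; rewrite ?ltry // -EFinB ltry.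
- have sub : (`[u, v]%classic `*` setT : set cylinder) `<=` J `*` setT.
    by move=> [r x] [/= /uvJ jr _].
  apply: measurable_funS sub (continuous_cylinder_measurable cf).
  by apply: measurableX => //; exact: ioo_measurable.
- have [C HC] := continuous_cylinder_bounded cf uvJ.
  exists C; split; first exact: num_real.
  move=> M CM [r x] [/= ruv _]; apply: le_trans (ltW CM); apply: HC.
  by move: ruv; rewrite in_itv.
Qed.

Lemma continuous_slice_integrable (f : R * N -> R) r :
  (forall r x, J r -> f @ nbhs (r, x) --> f (r, x)) -> J r ->
  mu.-integrable setT (fun x : borel N => (f (r, x))%:E).
Proof.
move=> cf jr.
rewrite -[fun x => _]/(EFin \o (fun x : borel N => f (r, x))).
apply: measurable_bounded_integrable => //.
  apply: continuous_borel_measurable => x.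
  apply: (@cvg_comp _ _ _ (fun x => (r, x)) f _ (nbhs (r, x))); last exact: cf.
  exact: cvg_slice_r.
have rJ : `[r, r]%classic `<=` J by move=> s /=; rewrite in_itv /= -eq_le => /eqP <-.
have [C HC] := continuous_cylinder_bounded cf rJ.
exists C; split; first exact: num_real.
by move=> M CM x _; apply: le_trans (ltW CM); apply: HC; rewrite lexx.
Qed.

(** The fundamental theorem of calculus on each radial segment, integrated over
    the base by Fubini. *)
Lemma integral_radial_derivative (f : R -> N -> R) u v :
  radial_C1 J setT f -> u < v -> `[u, v]%classic `<=` J ->
  (\int[(leb \x mu)%E]_(p in `[u, v]%classic `*` setT : set cylinder)
      (derive1 (f ^~ p.2) p.1)%:E =
   ((\int[mu]_x f v x)%R - (\int[mu]_x f u x)%R)%:E)%E.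
Proof.
move=> Cf uv uvJ.
have ju : J u by apply: uvJ; rewrite /= in_itv /= lexx ltW.
have jv : J v by apply: uvJ; rewrite /= in_itv /= lexx ltW.
have cf r x : J r -> (fun p => f p.1 p.2) @ nbhs (r, x) --> f r x.
  by move=> jr; have [] := Cf r x jr I.
pose f' (p : R * N) := derive1 (f ^~ p.2) p.1.
have cf' r x : J r -> f' @ nbhs (r, x) --> f' (r, x).
  by move=> jr; have [] := Cf r x jr I.
set D : set cylinder := _ `*` _.
have If' : (leb \x mu)%E.-integrable setT ((EFin \o f') \_ D).
  apply: (integrable_mkcond _ (strip_measurable u v)).1.
  exact: continuous_strip_integrable cf' uvJ.
rewrite integral_mkcond -(integral21_prod_meas1 If') /fubini_G.
transitivity (\int[mu]_x ((f v x)%:E - (f u x)%:E))%E.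
  apply: eq_integral => x _.
  transitivity (\int[leb]_(r in `[u, v]) (f' (r, x))%:E)%E.
    rewrite [RHS]integral_mkcond; apply: eq_integral => r _.
    rewrite !patchE /D; congr (if _ then _ else _).
    by apply/idP/idP => /set_mem; [move=> [/= ? _]; apply/mem_set|
      move=> ?; apply/mem_set; split].
  have fr r : J r -> {for r, continuous (f ^~ x)}.
    move=> jr; have [dr _ _] := Cf r x jr I.
    exact/differentiable_continuous/derivable1_diffP.
  apply: (continuous_FTC2 (F := f ^~ x)) => //.
  - apply: continuous_in_subspaceT => r; rewrite inE => /uvJ jr.
    apply: (@cvg_comp _ _ _ (fun r => (r, x)) f' _ (nbhs (r, x))); last exact: cf'.
    exact: cvg_slice_l.
  - split.
    + move=> r ruv; have jr : J r.
        by apply: uvJ; move: ruv => /=; rewrite !in_itv /= => /andP[/ltW -> /ltW ->].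
      by have [dr _ _] := Cf r x jr I.
    + by apply: cvg_at_right_filter; exact: fr.
    + by apply: cvg_at_left_filter; exact: fr.
have Iv := continuous_slice_integrable (f := fun p => f p.1 p.2) (fun r x => cf r x) jv.
have Iu := continuous_slice_integrable (f := fun p => f p.1 p.2) (fun r x => cf r x) ju.
rewrite integralB_EFin // /Rintegral EFinB !fineK //; exact: integrable_fin_num.
Qed.

End CylinderIntegral.

(** * Approaching the ends of the cylinder *)

Lemma ereal_between (R : realType) (x y : \bar R) :
  (x < y)%E -> exists r : R, (x < r%:E < y)%E.
Proof.
case: x y => [x||] [y||] //= xy.
- exists ((x + y) / 2); rewrite !lte_fin; move: xy; rewrite lte_fin => xy; lra.
- by exists (x + 1); rewrite lte_fin ltrDl ltr01 ltry.
- by exists (y - 1); rewrite lte_fin ltrBlDr ltrDl ltr01 ltNyr.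
- by exists 0; rewrite ltNyr ltry.
Qed.

Section Ends.
Variables (R : realType) (a b : \bar R).
Hypothesis hab : (a < b)%E.

Local Notation J := (ioo a b).

Lemma ioo_nonempty : exists r, J r.
Proof. exact: ereal_between hab. Qed.

Lemma ioo_itv u v : J u -> J v -> `[u, v]%classic `<=` J.
Proof.
move=> /andP[au _] /andP[_ vb] r /=; rewrite in_itv /= => /andP[ur rv].
by rewrite /ioo /= (lt_le_trans au) ?lee_fin // (le_lt_trans _ vb) // lee_fin.
Qed.

(** Every point of the closed interval is adherent to the open one, also at
    infinity, so that [to_within] is a proper filter. *)
Lemma to_within_nonempty (r0 : \bar R) (U : set (\bar R)) :
  (a <= r0 <= b)%E -> nbhs r0 U -> exists r, J r /\ U r%:E.
Proof.
have between x y : (x < y)%E -> (x < b)%E -> (a < y)%E ->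
    exists r : R, J r /\ (x < r%:E < y)%E.
  move=> xy xb ay.
  have : (Order.max a x < Order.min b y)%E by rewrite gt_max !lt_min hab ay xb xy.
  move=> /ereal_between[r]; rewrite gt_max lt_min => /andP[/andP[ar xr] /andP[rb ry]].
  by exists r; rewrite /ioo /= ar rb xr ry.
case: r0 => [r||] /andP[ar rb] nU.
- have nU' : \forall s \near r, U s%:E by exact: nU.
  have [e /= e0 eU] := (nbhs_ballP _ _).1 nU'.
  have [|||s [js /andP[s1 s2]]] := between (r - e)%:E (r + e)%:E.
  + by rewrite lte_fin; lra.
  + by apply: lt_le_trans rb; rewrite lte_fin; lra.
  + by apply: le_lt_trans ar _; rewrite lte_fin; lra.
  exists s; split => //; apply: eU; rewrite /ball /= ltr_norml.
  by move: s1 s2; rewrite !lte_fin => s1 s2; apply/andP; split; lra.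
- have [M [_ MU]] := nU; have by_ : b = +oo%E by move: rb; rewrite leye_eq => /eqP.
  have [|||s [js /andP[s1 _]]] := between M%:E +oo%E; rewrite ?ltry //.
  + by rewrite by_ ltry.
  + by rewrite -by_.
  by exists s; split => //; exact: MU.
- have [M [_ MU]] := nU; have ay_ : a = -oo%E by move: ar; rewrite leeNy_eq => /eqP.
  have [|||s [js /andP[_ s1]]] := between -oo%E M%:E; rewrite ?ltNyr //.
  + by rewrite -ay_.
  + by rewrite ay_ ltNyr.
  by exists s; split => //; exact: MU.
Qed.

Lemma to_within_seq (r0 : \bar R) : (a <= r0 <= b)%E ->
  exists u : nat -> R, [/\ forall k, J (u k), u @ \oo --> to_within a b r0 &
    (fun k => (u k)%:E) @ \oo --> r0].
Proof.
move=> ar0b.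
have seqk k : exists r, J r /\ ball r0 (k.+1%:R^-1 : R) r%:E.
  apply: (to_within_nonempty (U := ball r0 (k.+1%:R^-1 : R)) ar0b).
  by apply: nbhsx_ballx; rewrite invr_gt0.
have [u uP] := choice seqk.
have uU U : nbhs r0 U -> \forall k \near \oo, U (u k)%:E.
  move=> /nbhs_ballP[e /= e0 eU].
  near=> k; apply: eU; apply: (@le_ball _ _ r0 (k.+1%:R^-1)); last by have [] := uP k.
  by apply/ltW; near: k; exact: near_infty_natSinv_lt (PosNum e0).
exists u; split; [by move=> k; have [] := uP k | | exact: uU].
move=> P [U nU UP]; have := uU U nU; apply: filterS => k Uk.
by apply: UP; split => //; have [] := uP k.
Unshelve. all: by end_near. Qed.

End Ends.

(** * The integral inequality and its equality case *)

Section IntegralInequality.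
Variables (R : realType) (m : nat) (N : manifold R m) (a b : \bar R).
Hypothesis hab : (a < b)%E.
Hypothesis cN : compact [set: N].
Variable mu : {sigma_finite_measure set (borel N) -> \bar R}.
Hypothesis mu_finite : (mu setT < +oo)%E.

Local Notation J := (ioo a b).
Local Notation leb := (@lebesgue_measure R).
Local Notation cylinder := (measurableTypeR R * borel N)%type.
Local Notation strip u v := (`[u, v]%classic `*` setT : set cylinder).

Variables (f q : R -> N -> R) (e : R * N -> R).
Hypothesis f_C1 : radial_C1 J setT f.
Hypothesis q_C1 : radial_C1 J setT q.
Hypothesis q_ge0 : forall r x, J r -> 0 <= q r x.
Hypothesis eE : forall r x, J r -> e (r, x) = derive1 (f ^~ x) r - q r x.
Hypothesis e_int :
  (leb \x mu)%E.-integrable (J `*` setT : set cylinder) (fun p => (e p)%:E).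
Variables Ma Mb : R.
Hypothesis hMa : (fun r => \int[mu]_x f r x)%R @ to_within a b a --> Ma.
Hypothesis hMb : (fun r => \int[mu]_x f r x)%R @ to_within a b b --> Mb.

Let qp (p : R * N) := q p.1 p.2.

Lemma strip_defect_integrable u v : J u -> J v ->
  (leb \x mu)%E.-integrable (strip u v) (fun p => (qp p)%:E).
Proof.
move=> ju jv; apply: (continuous_strip_integrable cN mu_finite (f := qp)) (ioo_itv ju jv).
by move=> r x jr; have [] := q_C1 jr (I : [set: N] x).
Qed.

Lemma integral_strip u v : J u -> J v -> u < v ->
  (\int[(leb \x mu)%E]_(p in strip u v) (e p)%:E =
   ((\int[mu]_x f v x)%R - (\int[mu]_x f u x)%R)%:E
     - \int[(leb \x mu)%E]_(p in strip u v) (qp p)%:E)%E.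
Proof.
move=> ju jv uv; have uvJ := ioo_itv ju jv.
rewrite -(integral_radial_derivative cN mu_finite f_C1 uv uvJ).
have If : (leb \x mu)%E.-integrable (strip u v)
    (fun p => (derive1 (f ^~ p.2) p.1)%:E).
  apply: (continuous_strip_integrable cN mu_finite
    (f := fun p => derive1 (f ^~ p.2) p.1)) uvJ.
  by move=> r x jr; have [] := f_C1 jr (I : [set: N] x).
rewrite -(integralB (strip_measurable u v) If (strip_defect_integrable ju jv)).
apply: eq_integral => -[r x]; rewrite inE => -[/= /uvJ jr _].
by rewrite eE // EFinB.
Qed.

(** On a strip the integral of [e] is the increment of the integral of [f]
    minus the integral of the defect [q], and the latter only grows with the
    strip. Exhausting the cylinder by strips, the integrals of [e] converge by
    dominated convergence. *)
Lemma integral_excess_le u v : J u -> J v ->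
  (\int[(leb \x mu)%E]_(p in J `*` setT : set cylinder) (e p)%:E
    <= (Mb - Ma)%:E - \int[(leb \x mu)%E]_(p in strip u v) (qp p)%:E)%E.
Proof.
move=> ju jv.
have [s [js sa sea]] : exists s : nat -> R, [/\ forall k, J (s k),
    s @ \oo --> to_within a b a & (fun k => (s k)%:E) @ \oo --> a].
  by apply: to_within_seq; rewrite ?lexx ?ltW.
have [t [jt tb teb]] : exists t : nat -> R, [/\ forall k, J (t k),
    t @ \oo --> to_within a b b & (fun k => (t k)%:E) @ \oo --> b].
  by apply: to_within_seq; rewrite ?lexx ?ltW.
have below r : J r -> \forall k \near \oo, s k < r.
  move=> /andP[ar _]; have na : nbhs a [set y | (y < r%:E)%E].
    by apply: open_nbhs_nbhs; split => //; exact: open_ereal_lt_ereal.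
  have : \forall k \near \oo, ((s k)%:E < r%:E)%E by exact: sea na.
  by apply: filterS => k; rewrite lte_fin.
have above r : J r -> \forall k \near \oo, r < t k.
  move=> /andP[_ rb]; have nb : nbhs b [set y | (r%:E < y)%E].
    by apply: open_nbhs_nbhs; split => //; exact: open_ereal_gt_ereal.
  have : \forall k \near \oo, (r%:E < (t k)%:E)%E by exact: teb nb.
  by apply: filterS => k; rewrite lte_fin.
pose D : set cylinder := J `*` setT.
have mD : measurable D by apply: measurableX => //; exact: ioo_measurable.
have sD k : strip (s k) (t k) `<=` D.
  by move=> [r x] [/= /(ioo_itv (js k) (jt k)) jr _].
have me : measurable_fun D (fun p => (e p)%:E) by exact: measurable_int e_int.
have cvI : (\int[(leb \x mu)%E]_(p in strip (s k) (t k)) (e p)%:E)%E @[k --> \oo]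
    --> (\int[(leb \x mu)%E]_(p in D) (e p)%:E)%E.
  pose ek k : cylinder -> \bar R := (fun p => (e p)%:E) \_ (strip (s k) (t k)).
  have -> : (fun k => \int[(leb \x mu)%E]_(p in strip (s k) (t k)) (e p)%:E)%E =
      (fun k => \int[(leb \x mu)%E]_(p in D) ek k p)%E.
    apply/funext => k; rewrite -integral_mkcondr; congr (integral _ _ _).
    by apply/esym/setIidPr; exact: sD.
  have [|||||_ _ //] := @dominated_convergence _ _ _ (leb \x mu)%E D mD ek
    (fun p => (e p)%:E) (fun p => `|(e p)%:E|%E).
  - move=> k; apply: (measurable_restrict _ (strip_measurable (s k) (t k)) mD).1.
    by apply: measurable_funS me => // p [].
  - exact: me.
  - apply: aeW => -[r x] [/= jr _].
    apply: cvg_near_cst; near=> k; rewrite /ek patchE mem_set //.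
    split => //=; rewrite in_itv /=; apply/andP; split; apply/ltW.
      by near: k; exact: below.
    by near: k; exact: above.
  - exact: integrable_abse.
  - apply: aeW => p k Dp; rewrite /ek patchE; case: ifP => // _.
    by rewrite abse0 abse_ge0.
have Iq := integrable_fin_num (strip_measurable u v) (strip_defect_integrable ju jv).
have cvM : ((\int[mu]_x f (t k) x)%R - (\int[mu]_x f (s k) x)%R)%:E @[k --> \oo]
    --> (Mb - Ma)%:E.
  apply: cvg_EFin; first exact: nearW.
  by apply: cvgB; [exact: cvg_comp tb hMb | exact: cvg_comp sa hMa].
apply: (lee_cvg_to cvI (g := fun k =>
  ((\int[mu]_x f (t k) x)%R - (\int[mu]_x f (s k) x)%R)%:E -
  \int[(leb \x mu)%E]_(p in strip u v) (qp p)%:E)%E).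
  apply: cvgeB; [by rewrite fin_num_adde_defr | exact: cvM | exact: cvg_cst].
near=> k.
have su : s k < u by near: k; exact: below.
have sv : s k < v by near: k; exact: below.
have ut : u < t k by near: k; exact: above.
have vt : v < t k by near: k; exact: above.
rewrite (integral_strip (js k) (jt k) (lt_trans su ut)); apply: leeB => //.
apply: ge0_subset_integral.
- exact: strip_measurable.
- exact: strip_measurable.
- exact: measurable_int (strip_defect_integrable (js k) (jt k)).
- by move=> [r x] [/= /(ioo_itv (js k) (jt k)) jr _]; rewrite lee_fin; exact: q_ge0.
- move=> [r x] [/=]; rewrite !in_itv /= => /andP[ur rv] _; split => //=.
  by rewrite (le_trans (ltW su) ur) (le_trans rv (ltW vt)).
Unshelve. all: by end_near. Qed.

Lemma integral_excess_le0 : Mb <= Ma ->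
  (\int[(leb \x mu)%E]_(p in J `*` setT : set cylinder) (e p)%:E <= 0)%E.
Proof.
move=> hM; have [r jr] := ioo_nonempty hab.
apply: (le_trans (integral_excess_le jr jr)).
rewrite sube_le0; apply: (@le_trans _ _ 0%E); first by rewrite lee_fin subr_le0.
apply: integral_ge0 => -[s x] [/= /(ioo_itv jr jr) js _].
by rewrite lee_fin; exact: q_ge0.
Qed.

Hypothesis mu_open : forall U : set N, open U -> U !=set0 -> (0 < mu U)%E.

(** A continuous nonnegative defect that is positive somewhere is bounded below
    on an open rectangle, which has positive measure. *)
Lemma defect_eq0 : Mb <= Ma ->
  (\int[(leb \x mu)%E]_(p in J `*` setT : set cylinder) (e p)%:E = 0)%E ->
  forall r x, J r -> q r x = 0.
Proof.
move=> hM I0 r x jr; apply/eqP; rewrite eq_le q_ge0 // andbT leNgt.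
apply/negP => q0.
have [_ cq _] := q_C1 jr (I : [set: N] x).
have [[A C] /= [nA nC] AC] : \forall p \near (r, x), J p.1 /\ q r x / 2 < q p.1 p.2.
  apply: filterS2 (near_rectangle (@ioo_open R a b) openT jr (I : [set: N] x))
    (cq _ (open_nbhs_nbhs (conj (@open_gt _ (q r x / 2)) _))) => [p [jp _] qp'|].
    by split.
  by rewrite /= ltr_pdivrMr // ltr_pMr // ltr1n.
(* half the radius, as the closed interval [u, v] must lie in the open ball *)
have [d /= d0 dA] := (nbhs_ballP _ _).1 nA.
pose u := r - d / 2; pose v := r + d / 2.
have Cx : C x by exact: nbhs_singleton.
have uvA s : u <= s <= v -> A s.
  move=> /andP[us sv]; apply: dA; rewrite /ball /= ltr_norml.
  by rewrite /u /v in us sv; apply/andP; split; lra.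
have inner s y : u <= s <= v -> C y -> J s /\ q r x / 2 < q s y.
  by move=> suv Cy; apply: (AC (s, y)); split => //=; exact: uvA.
have ju : J u by have [] := inner u x _ Cx; rewrite // lexx /u /v; lra.
have jv : J v by have [] := inner v x _ Cx; rewrite // lexx andbT /u /v; lra.
have Iq := strip_defect_integrable ju jv.
have := integral_excess_le ju jv; rewrite I0 sube_ge0; last first.
  by rewrite (integrable_fin_num (strip_measurable u v) Iq) ?orbT.
apply/negP; rewrite -ltNge.
apply: (@le_lt_trans _ _ 0%E); first by rewrite lee_fin subr_le0.
pose S : set cylinder := `[u, v]%classic `*` C°.
have mS : measurable S.
  apply: measurableX; first exact: measurable_itv.
  by apply: borel_open; exact: open_interior.
apply: (@lt_le_trans _ _ (\int[(leb \x mu)%E]_(p in S) (q r x / 2)%:E)%E).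
  rewrite integral_cst //.
  have SE : (leb \x mu)%E S = (leb `[u, v]%classic * mu (C° : set N))%E.
    apply: product_measure1E; first exact: measurable_itv.
    by apply: borel_open; exact: open_interior.
  apply: mule_gt0; first by rewrite lte_fin divr_gt0.
  rewrite [X in (_ < X)%E]SE; apply: mule_gt0.
    have uv : u < v by rewrite /u /v; lra.
    by rewrite lebesgue_measure_itv /= lte_fin uv -EFinB lte_fin subr_gt0.
  by apply: mu_open; [exact: open_interior | exists x].
have SD : S `<=` strip u v by move=> [s y] [].
apply: (@le_trans _ _ (\int[(leb \x mu)%E]_(p in S) (qp p)%:E)%E).
  apply: ge0_le_integral => //.
  - by move=> p _; rewrite lee_fin divr_ge0 // ltW.
  - by apply: measurable_funS (measurable_int _ Iq) => //; exact: strip_measurable.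
  - move=> [s y] [/=]; rewrite in_itv => suv /interior_subset Cy.
    by rewrite lee_fin; have [_ /ltW] := inner s y suv Cy.
apply: ge0_subset_integral => //; first exact: strip_measurable.
- exact: measurable_int Iq.
- by move=> [s y] [/= /(ioo_itv ju jv) js _]; rewrite lee_fin; exact: q_ge0.
Qed.

End IntegralInequality.

(** * Rigidity *)

Lemma eq_Ck (R : realType) (d k : nat) (U : set 'rV[R]_d) (F F' : 'rV[R]_d -> R) :
  open U -> (forall x, U x -> F x = F' x) -> Ck k U F -> Ck k U F'.
Proof.
move=> oU; elim: k F F' => [|k IH] F F' FF' [cF dF].
  split=> // x Ux; rewrite /prop_for /continuous_at -(FF' x Ux).
  move: (cF x Ux); apply: cvg_trans; apply: (@near_eq_cvg _ _ (nbhs x)).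
  by apply: filterS (open_nbhs_nbhs (conj oU Ux)) => y /FF' ->.
split=> [x Ux|].
  rewrite /prop_for /continuous_at -(FF' x Ux).
  move: (cF x Ux); apply: cvg_trans; apply: (@near_eq_cvg _ _ (nbhs x)).
  by apply: filterS (open_nbhs_nbhs (conj oU Ux)) => y /FF' ->.
have near_FF' x : U x -> \forall y \near x, F y = F' y.
  by move=> Ux; apply: filterS (open_nbhs_nbhs (conj oU Ux)) => y /FF'.
move=> i; have [dFi CFi] := dF i; split.
  by move=> x Ux; apply: near_eq_derivable (dFi x Ux); exact: near_FF'.
by apply: IH CFi => x Ux; apply: near_eq_derive; exact: near_FF'.
Qed.

Lemma CkZ (R : realType) (d k : nat) (U : set 'rV[R]_d) (F : 'rV[R]_d -> R) (c : R) :
  open U -> Ck k U F -> Ck k U (fun x => c * F x).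
Proof.
move=> oU; have cont (u : 'rV[R]_d -> R) x : {for x, continuous u} ->
    {for x, continuous (fun y => c * u y)}.
  move=> cu; apply: (@continuousM _ _ (cst c) u x) cu; exact: cst_continuous.
elim: k F => [|k IH] F [cF dF].
  by split=> // x Ux; apply: cont; exact: cF.
split=> [x Ux|i]; first by apply: cont; exact: cF.
have [dFi CFi] := dF i.
have dc x : derivable (fun _ : 'rV[R]_d => c) x (basis_vec R i) := derivable_cst _ _ _.
split=> [x Ux|]; first exact: (derivableM (dc x) (dFi x Ux)).
apply: eq_Ck (IH _ CFi) => // x Ux.
by rewrite (deriveM (dc x) (dFi x Ux)) derive_cst scaler0 addr0.
Qed.

Lemma riemannianZ (R : realType) (m : nat) (N : manifold R m) (T : tensor2 N) (k : R) :
  0 < k -> riemannian T -> riemannian (fun c x => k *: T c x).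
Proof.
move=> k0 [pT sT tT]; split.
- move=> c x ac cx; have [symT posT] := pT c x ac cx; split.
    by rewrite linearZ /= symT.
  by move=> v v0; rewrite -scalemxAr -scalemxAl mxE mulr_gt0 // posT.
- move=> c i j ac y iy; have [U [F [oU Uy CF TF]]] := sT c i j ac y iy.
  exists U, (fun x => k * F x); split => //; first by move=> l; exact: CkZ.
  by move=> w Uw iw; rewrite mxE TF.
- move=> c c' x ac ac' cx cx'; rewrite (tT c c') //.
  by rewrite -scalemxAr -scalemxAl.
Qed.

Section Rigidity.
Variables (R : realType) (m : nat) (N : manifold R m) (a b : \bar R).
Variables (h : R -> R) (Ghat : tensor2 N) (G : R -> tensor2 N).
Hypothesis hab : (a < b)%E.
Hypothesis hG : metric_family a b G.
Hypothesis hsmooth : smooth_fun a b h.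
Hypothesis hpos : forall r, ioo a b r -> 0 < h r.
Hypothesis hGhat : riemannian Ghat.

Local Notation J := (ioo a b).
Local Notation kappa := (log_derivative h).

Lemma derive1_eq0_on_ioo (u : R -> R) r s : J r -> J s ->
  (forall t, J t -> derivable u t 1 /\ derive1 u t = 0) -> u r = u s.
Proof.
wlog rs : r s / r <= s => [hw|] jr js du.
  by case: (leP r s) => [|/ltW] rs; [exact: hw | apply/esym; exact: hw].
have sub := ioo_itv jr js.
have [| |z _] := @MVT_segment _ u (fun=> 0) r s rs.
- move=> z rsz; have jz : J z.
    by apply: sub; move: rsz => /=; rewrite !in_itv /= => /andP[/ltW -> /ltW ->].
  by have [dz z0] := du z jz; apply: DeriveDef => //; rewrite -derive1E.
- apply: continuous_in_subspaceT => z; rewrite inE => /sub jz.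
  exact/differentiable_continuous/derivable1_diffP/(du z jz).1.
- by rewrite mul0r => /eqP; rewrite subr_eq0 => /eqP.
Qed.

(** The hypothesis says that the components of [G] divided by the square of [h]
    have derivative zero. *)
Lemma umbilic_warped c x r s : atlas c -> cdom c x -> J r -> J s ->
  (forall t, J t -> radial_derivative G t c x = (2 * kappa t) *: G t c x) ->
  G r c x = h r ^+ 2 *: (h s ^- 2 *: G s c x).
Proof.
move=> ac cx jr js dG.
have h0 t : J t -> h t != 0 by move=> jt; rewrite gt_eqF // hpos.
suff E i j : G r c x i j * (h r * h r)^-1 = G s c x i j * (h s * h s)^-1.
  apply/matrixP => i j; rewrite !mxE expr2 [_^-1 * _]mulrC -E mulrCA.
  by rewrite mulfV ?mulr1 // mulf_neq0 // h0.
apply: (derive1_eq0_on_ioo (u := fun t => G t c x i j * (h t * h t)^-1)) => // t jt.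
have [dGt _ _] := radial_C1_metric hG ac i j jt cx.
have dh := derivable_h hsmooth jt.
have hh0 : h t * h t != 0 by rewrite mulf_neq0 // h0.
have dhh : derivable (fun t => h t * h t) t 1 by exact: (derivableM dh dh).
have dV : derivable (fun t => (h t * h t)^-1) t 1 by exact: (derivableV (f := fun t => h t * h t) hh0 dhh).
split; first exact: (derivableM dGt dV).
rewrite derive1E (deriveM dGt dV) (deriveV (f := fun t => h t * h t) hh0 dhh) (deriveM dh dh) -!derive1E.
have /matrixP/(_ i j) := dG t jt; rewrite !mxE => ->.
rewrite /log_derivative /GRing.scale /=.
move: (h t) (derive1 h t) (G t c x i j) (h0 t jt) => z z' y z0.
by field.
Qed.

(** The vanishing of the defect is a statement in the preferred chart at each
    point; it is carried to the other charts by the transformation law, whose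
    Jacobian does not depend on [r]. *)
Lemma defect_eq0_warped : (forall r x, J r -> shape_defect h G r x = 0) ->
  exists2 Gtilde : tensor2 N, riemannian Gtilde &
    forall r, J r -> forall c x, atlas c -> cdom c x ->
      G r c x = h r ^+ 2 *: Gtilde c x.
Proof.
move=> q0; have [s js] := ioo_nonempty hab.
exists (fun c x => h s ^- 2 *: G s c x).
  by apply: riemannianZ; [rewrite invr_gt0 exprn_gt0 // hpos | exact: hG.1].
move=> r jr c x ac cx.
have ac' := @chart_at_atlas _ _ N x; have cx' := mem_chart_at x.
have [_ _ tr] := hG.1 r jr; have [_ _ ts] := hG.1 s js.
rewrite (tr c (chart_at x)) // (ts c (chart_at x)) //.
rewrite (umbilic_warped ac' cx' jr js) => [|t jt]; last first.
  by apply: (shape_defect_eq0 hG hpos) => //; exact: q0.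
by rewrite -!scalemxAr -!scalemxAl.
Qed.

Lemma warped_excess0 (Gtilde : tensor2 N) r x : riemannian Gtilde ->
  (forall s, J s -> forall c y, atlas c -> cdom c y ->
    G s c y = h s ^+ 2 *: Gtilde c y) ->
  J r -> ricci_excess a b h Ghat G (r, x) = 0.
Proof.
move=> [pT _ _] GE jr; have [pH _ _] := hGhat.
have ac := @chart_at_atlas _ _ N x; have cx := mem_chart_at x.
rewrite /ricci_excess /=.
rewrite (ricci_rr_warped hsmooth hpos (T := Ghat) (G' := warped h Ghat)) //; last first.
  by apply: posdef_unit; exact: pH.
rewrite (ricci_rr_warped hsmooth hpos (T := Gtilde) (G' := G)) //; last 2 first.
- by move=> s js; exact: GE.
- by apply: posdef_unit; exact: pT.
by rewrite subrr mulr0.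
Qed.

Lemma same_metricP : same_metric a b G (warped h Ghat) <->
  (forall r, J r -> forall c x, atlas c -> cdom c x ->
     G r c x = h r ^+ 2 *: Ghat c x).
Proof.
split=> [sG r jr c x ac cx|GE c z ac [jz [x cx xz]]].
  have := sG c (cyl_point r (cmap c x)) ac (cyl_domain_cmap jr cx).
  rewrite /cyl_metric cyl_point_radius cyl_point_base (cmapK ac cx).
  by move=> /eq_block_mx[].
by rewrite /cyl_metric -xz (cmapK ac cx) (GE _ jz) .
Qed.

(** The norm of the difference of two metrics with the same warping factor,
    measured by one of them, does not depend on the radius: if it is small near
    [r0] it is zero. *)
Lemma asymptotic_warped (Gtilde : tensor2 N) (r0 : \bar R) :
  (a <= r0 <= b)%E -> riemannian Gtilde ->
  (forall s, J s -> forall c y, atlas c -> cdom c y ->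
    G s c y = h s ^+ 2 *: Gtilde c y) ->
  asymptotic a b G (warped h Ghat) r0 ->
  forall c x, atlas c -> cdom c x -> Gtilde c x = Ghat c x.
Proof.
move=> ar0b [_ _ tT] GE asy c x ac cx; have [pH _ tH] := hGhat.
have ac' := @chart_at_atlas _ _ N x; have cx' := mem_chart_at x.
suff E : Gtilde (chart_at x) x = Ghat (chart_at x) x.
  by rewrite (tT c (chart_at x)) // (tH c (chart_at x)) // E.
have pHx := pH _ _ ac' cx'.
pose S := Gtilde (chart_at x) x - Ghat (chart_at x) x.
pose Hi := invmx (Ghat (chart_at x) x).
have norm_lt e : 0 < e -> Num.sqrt (\tr (Hi *m S *m Hi *m S^T)) < e.
  move=> e0; have [U nU UP] := asy e e0.
  have [r [jr Ur]] := to_within_nonempty hab ar0b nU.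
  have := UP r (conj jr Ur) x; rewrite /tensor_norm /warped (GE r jr) //.
  have hr0 : h r ^+ 2 != 0 by rewrite expf_neq0 // gt_eqF // hpos.
  rewrite -scalerBr invmxZ; last by rewrite unitmxZ ?unitfE // posdef_unit.
  rewrite -/S -/Hi [(_ *: S)^T]linearZ /=; set k := h r ^+ 2 in hr0 *.
  rewrite -!scalemxAl -!scalemxAr -?scalemxAl !scalerA.
  by rewrite [X in X *: _](_ : _ = 1) ?scale1r //; field.
have tr0 := trace_norm_ge0 S pHx.
have : Num.sqrt (\tr (Hi *m S *m Hi *m S^T)) = 0.
  apply/eqP; rewrite eq_le sqrtr_ge0 andbT leNgt; apply/negP => n0.
  by have := norm_lt _ n0; rewrite ltxx.
move=> /eqP; rewrite sqrtr_eq0 => tr_le0.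
apply/eqP; rewrite -subr_eq0; apply/eqP; apply: (trace_norm_eq0 pHx).
by apply/eqP; rewrite eq_le tr_le0 tr0.
Qed.

End Rigidity.

Unset Implicit Arguments.

Theorem corollary1p3 (R : realType) (n : nat) (hn : (2 <= n)%N)
    (N : manifold R n.-1) (hN : compact [set: N])
    (a b : \bar R) (hab : (a < b)%E)
    (G : R -> tensor2 N) (hG : metric_family a b G)
    (h : R -> R) (hsmooth : smooth_fun a b h)
    (hpos : forall r, ioo a b r -> 0 < h r)
    (Ghat : tensor2 N) (hGhat : riemannian Ghat)
    (mu : {sigma_finite_measure set (borel N) -> \bar R})
    (hmu : riemannian_measure Ghat mu)
    (Ma Mb : R)
    (hMa : relative_radial_mass mu h Ghat G r @[r --> to_within a b a] --> Ma)
    (hMb : relative_radial_mass mu h Ghat G r @[r --> to_within a b b] --> Mb)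
    (hint : ((@lebesgue_measure R) \x mu)%E.-integrable (ioo a b `*` [set: borel N])
              (fun p : R * borel N => (ricci_excess a b h Ghat G p)%:E))
    (hM : Mb <= Ma) :
  let I := (\int[((@lebesgue_measure R) \x mu)%E]_(p in ioo a b `*` [set: borel N])
              (ricci_excess a b h Ghat G p)%:E)%E in
  [/\ (I <= 0)%E,
      I = 0%E <->
        (exists2 Gtilde : tensor2 N, riemannian Gtilde &
           forall r, ioo a b r -> forall c x, atlas c -> cdom c x ->
             G r c x = h r ^+ 2 *: Gtilde c x) &
      forall r0 : \bar R, (a <= r0 <= b)%E ->
        asymptotic a b G (warped h Ghat) r0 ->
        (I = 0%E <-> same_metric a b G (warped h Ghat))].
Proof.
move=> I; have mu_fin := riemannian_measure_finite hGhat hmu hN.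
have f_C1 := radial_C1_radial_mass hG hsmooth hpos hGhat.
have q_C1 := radial_C1_shape_defect hG hsmooth hpos.
have q_ge0 r x : ioo a b r -> 0 <= shape_defect h G r x by exact: shape_defect_ge0.
have eE r x : ioo a b r -> ricci_excess a b h Ghat G (r, x) =
    derive1 (radial_mass h Ghat G ^~ x) r - shape_defect h G r x.
  exact: ricci_excessE.
have warped0 Gtilde : riemannian Gtilde ->
    (forall r, ioo a b r -> forall c x, atlas c -> cdom c x ->
      G r c x = h r ^+ 2 *: Gtilde c x) -> I = 0%E.
  move=> rT GE; apply: integral0_eq => -[r x] [/= jr _].
  by rewrite (warped_excess0 hsmooth hpos hGhat x rT GE jr).
have rigid : I = 0%E -> exists2 Gtilde : tensor2 N, riemannian Gtilde &
    forall r, ioo a b r -> forall c x, atlas c -> cdom c x ->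
      G r c x = h r ^+ 2 *: Gtilde c x.
  move=> I0; apply: (defect_eq0_warped hab hG hsmooth hpos) => r x jr.
  apply: (defect_eq0 hab hN mu_fin f_C1 q_C1 q_ge0 eE hint hMa hMb _ hM I0) => //.
  exact: riemannian_measure_open_gt0 hGhat _ hmu.
split.
- exact: (integral_excess_le0 hab hN mu_fin f_C1 q_C1 q_ge0 eE hint hMa hMb hM).
- by split=> [|[Gtilde rT GE]]; [exact: rigid | exact: warped0 rT GE].
- move=> r0 ar0b asy; rewrite same_metricP; split=> [I0|]; last exact: warped0.
  have [Gtilde rT GE] := rigid I0 => r jr c x ac cx.
  rewrite (GE r jr) //; congr (_ *: _).
  exact: (asymptotic_warped hab hpos hGhat ar0b rT GE asy).
Qed.
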